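(* Let $X$ be a subshift over a non-empty alphabet $\mathscr{A}$ and let $R$ be a field. Then the unital subshift algebra $\widetilde{\mathcal{A}}_R(X)$ is semiprimitive.
   Context: Conventions: $\mathbb{N}=\{0,1,2,\ldots\}$. $\mathscr{A}$ is a non-empty (possibly infinite) set, the alphabet; $\mathscr{A}^*$ is the set of finite words over $\mathscr{A}$, $\omega$ the empty word, $\beta\alpha$ concatenation. A subshift $X\subseteq\mathscr{A}^{\mathbb{N}}$ is a set of the form $X=X_F$ for some $F\subseteq\mathscr{A}^*$, where $X_F$ is the set of all sequences in $\mathscr{A}^{\mathbb{N}}$ containing no word of $F$ as a (consecutive) subword. The language $\mathcal{L}_X$ is the set of all finite words (including $\omega$) that appear in some sequence of $X$. For $\alpha,\beta\in\mathcal{L}_X$ let $C(\alpha,\beta)=\{\beta x\in X:\alpha x\in X\}$; note $X=C(\omega,\omega)$. $\mathcal{U}$ is the Boolean algebra of subsets of $X$ generated by all $C(\alpha,\beta)$, $\alpha,\beta\in\mathcal{L}_X$. The unital subshift algebra $\widetilde{\mathcal{A}}_R(X)$ is the universal unital $R$-algebra with generators $\{p_A:A\in\mathcal{U}\}$ and $\{s_a,s_a^*:a\in\mathscr{A}\}$ subject to: (i) $p_X=1$, $p_{A\cap B}=p_Ap_B$, $p_{A\cup B}=p_A+p_B-p_{A\cap B}$, $p_\emptyset=0$ for all $A,B\in\mathcal{U}$; (ii) $s_as_a^*s_a=s_a$ and $s_a^*s_as_a^*=s_a^*$ for all $a\in\mathscr{A}$; (iii) $s_\beta s_\alpha^*s_\alpha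 s_\beta^*=p_{C(\alpha,\beta)}$ for all $\alpha,\beta\in\mathcal{L}_X$, where $s_\omega=s_\omega^*=1$ and, for $\alpha=\alpha(1)\cdots\alpha(n)$, $s_\alpha=s_{\alpha(1)}\cdots s_{\alpha(n)}$ and $s_\alpha^*=s_{\alpha(n)}^*\cdots s_{\alpha(1)}^*$. A ring $S$ is semiprimitive if its Jacobson radical (the intersection of all primitive ideals of $S$) is zero. *)

(* Defs.v *)
From HB Require Import structures.
From mathcomp Require Import all_boot all_algebra.
From mathcomp Require Import boolp classical_sets.

Set Implicit Arguments.
Unset Strict Implicit.
Unset Printing Implicit Defensive.

Import GRing.Theory.
Local Open Scope classical_set_scope.
Local Open Scope ring_scope.

(** * Semiprimitive rings *)

Section Semiprimitive.
Variable S : pzRingType.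

Definition simple_module (M : lmodType S) : Prop :=
  (exists m : M, m <> 0) /\
  forall N : {pred M}, submod_closed N ->
    (forall m, m \in N -> m = 0) \/ (forall m, m \in N).

(* The zero ring has no simple modules, hence no primitive ideals; its Jacobson
   radical is then the empty intersection, i.e. the whole ring. *)
Definition primitive_ideal (I : set S) : Prop :=
  exists M : lmodType S,
    simple_module M /\ I = [set a | forall m : M, a *: m = 0].

Definition jacobson_radical : set S := \bigcap_(I in primitive_ideal) I.

Definition semiprimitive : Prop := jacobson_radical = [set 0].

End Semiprimitive.

(** * Subshifts *)

Section Subshift.
Variable A : Type.
Implicit Types (w al be : seq A) (x y : nat -> A) (X : set (nat -> A)).

Definition occurs w x : Prop :=
  exists i, mkseq (fun k => x (i + k)%N) (size w) = w.

Definition avoiding (F : set (seq A)) : set (nat -> A) :=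
  [set x | forall w, F w -> ~ occurs w x].

Definition subshift X : Prop := exists F, X = avoiding F.

Definition language X : set (seq A) := [set w | exists2 x, X x & occurs w x].

Definition concat w x : nat -> A :=
  fun n => if (n < size w)%N then nth (x 0%N) w n else x (n - size w)%N.

Definition Cset X al be : set (nat -> A) :=
  [set y | exists2 x, y = concat be x & X (concat be x) /\ X (concat al x)].

(* The Boolean algebra of subsets of X generated by the C(al, be);
   complements are relative to X. *)
Inductive boolean_algebra X : set (nat -> A) -> Prop :=
| BA_C al be : language X al -> language X be -> boolean_algebra X (Cset X al be)
| BA_full : boolean_algebra X X
| BA_empty : boolean_algebra X set0
| BA_compl Y : boolean_algebra X Y -> boolean_algebra X (X `\` Y)
| BA_cap Y Z :
    boolean_algebra X Y -> boolean_algebra X Z -> boolean_algebra X (Y `&` Z)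
| BA_cup Y Z :
    boolean_algebra X Y -> boolean_algebra X Z -> boolean_algebra X (Y `|` Z).

Definition BA X := {Y : set (nat -> A) | boolean_algebra X Y}.

Definition baC X al be (hal : language X al) (hbe : language X be) : BA X :=
  exist _ _ (BA_C hal hbe).
Definition ba1 X : BA X := exist _ _ (BA_full X).
Definition ba0 X : BA X := exist _ _ (BA_empty X).
Definition baI X (Y Z : BA X) : BA X :=
  exist _ _ (BA_cap (proj2_sig Y) (proj2_sig Z)).
Definition baU X (Y Z : BA X) : BA X :=
  exist _ _ (BA_cup (proj2_sig Y) (proj2_sig Z)).

End Subshift.

(** * The unital subshift algebra *)

Section SubshiftAlgebra.
Variables (R : comPzRingType) (A : Type) (X : set (nat -> A)).

(* A unital R-algebra is given as a ring B with a ring morphism iota : R -> B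
   whose values are central: [algType R] would exclude the zero ring, which is
   the subshift algebra of the empty subshift. *)
Section Family.
Variables (B : pzRingType) (iota : {rmorphism R -> B}).
Variables (p : BA X -> B) (s t : A -> B).

Definition word_s (w : seq A) : B := \prod_(a <- w) s a.
Definition word_t (w : seq A) : B := \prod_(a <- rev w) t a.

(* t a stands for s_a^* *)
Record subshift_family : Prop := SubshiftFamily {
  sf_central : forall r b, iota r * b = b * iota r;
  sf_p1 : p (ba1 X) = 1;
  sf_pI : forall Y Z, p (baI Y Z) = p Y * p Z;
  sf_pU : forall Y Z, p (baU Y Z) = p Y + p Z - p (baI Y Z);
  sf_p0 : p (ba0 X) = 0;
  sf_sts : forall a, s a * t a * s a = s a;
  sf_tst : forall a, t a * s a * t a = t a;
  sf_C : forall al be (hal : language X al) (hbe : language X be),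
    word_s be * word_t al * word_s al * word_t be = p (baC hal hbe) }.

End Family.

Inductive expr : Type :=
| Scal of R | Proj of BA X | Gen of A | GenStar of A
| Add of expr & expr | Opp of expr | Mul of expr & expr.

HB.instance Definition _ := gen_eqMixin expr.
HB.instance Definition _ := gen_choiceMixin expr.

Fixpoint eval (B : pzRingType) (iota : {rmorphism R -> B}) (p : BA X -> B)
    (s t : A -> B) (u : expr) : B :=
  match u with
  | Scal r => iota r
  | Proj Y => p Y
  | Gen a => s a
  | GenStar a => t a
  | Add u v => eval iota p s t u + eval iota p s t v
  | Opp u => - eval iota p s t u
  | Mul u v => eval iota p s t u * eval iota p s t v
  end.

(* Two expressions in the generators are identified when they take the same
   value in every R-algebra with elements satisfying the relations; the quotient
   has the universal property, see subshift_alg_lift and subshift_alg_unique. *)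
Definition expr_eqv_prop (u v : expr) : Prop :=
  forall (B : pzRingType) (iota : {rmorphism R -> B}) p s t,
    subshift_family iota p s t -> eval iota p s t u = eval iota p s t v.

Definition expr_eqv : rel expr := fun u v => `[< expr_eqv_prop u v >].

Lemma expr_eqv_refl : reflexive expr_eqv.
Proof. by move=> u; apply/asboolP. Qed.

Lemma expr_eqv_sym : symmetric expr_eqv.
Proof.
by move=> u v; apply/asboolP/asboolP => h B iota p s t H; rewrite (h _ _ _ _ _ H).
Qed.

Lemma expr_eqv_trans : transitive expr_eqv.
Proof.
move=> v u w /asboolP h /asboolP k; apply/asboolP => B iota p s t H.
by rewrite (h _ _ _ _ _ H) (k _ _ _ _ _ H).
Qed.

Canonical expr_eqv_equiv :=
  EquivRel expr_eqv expr_eqv_refl expr_eqv_sym expr_eqv_trans.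

Definition subshift_alg := {eq_quot expr_eqv}%qT.
HB.instance Definition _ := Choice.on subshift_alg.
HB.instance Definition _ := EqQuotient.on subshift_alg.

Definition cls (u : expr) : subshift_alg := (\pi_subshift_alg u)%qT.

Lemma clsP u v : cls u = cls v <-> expr_eqv_prop u v.
Proof.
rewrite /cls; split=> [/eqP|h].
  by rewrite piE => /asboolP.
by apply/eqP; rewrite piE; apply/asboolP.
Qed.

Lemma cls_repr (x : subshift_alg) : cls (repr x) = x.
Proof. exact: reprK. Qed.

Lemma cls_ind (P : subshift_alg -> Prop) : (forall u, P (cls u)) -> forall x, P x.
Proof. by move=> h x; rewrite -(cls_repr x). Qed.

Definition sa_add (x y : subshift_alg) := cls (Add (repr x) (repr y)).
Definition sa_opp (x : subshift_alg) := cls (Opp (repr x)).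
Definition sa_mul (x y : subshift_alg) := cls (Mul (repr x) (repr y)).
Definition sa_iota (r : R) := cls (Scal r).

Lemma repr_cls u : expr_eqv_prop (repr (cls u)) u.
Proof. by apply/clsP; rewrite cls_repr. Qed.

Lemma sa_addE u v : sa_add (cls u) (cls v) = cls (Add u v).
Proof.
by apply/clsP => B iota p s t H /=; rewrite !(repr_cls _ H).
Qed.

Lemma sa_oppE u : sa_opp (cls u) = cls (Opp u).
Proof. by apply/clsP => B iota p s t H /=; rewrite (repr_cls _ H). Qed.

Lemma sa_mulE u v : sa_mul (cls u) (cls v) = cls (Mul u v).
Proof.
by apply/clsP => B iota p s t H /=; rewrite !(repr_cls _ H).
Qed.

Local Ltac by_eval :=
  do ?[elim/cls_ind=> ?]; rewrite /sa_iota ?(sa_addE, sa_oppE, sa_mulE);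
  apply/clsP => B iota p s t H /=.

Fact sa_addA : associative sa_add.
Proof. by by_eval; rewrite addrA. Qed.
Fact sa_addC : commutative sa_add.
Proof. by by_eval; rewrite addrC. Qed.
Fact sa_add0 : left_id (sa_iota 0) sa_add.
Proof. by by_eval; rewrite rmorph0 add0r. Qed.
Fact sa_addN : left_inverse (sa_iota 0) sa_opp sa_add.
Proof. by by_eval; rewrite rmorph0 addNr. Qed.
Fact sa_mulA : associative sa_mul.
Proof. by by_eval; rewrite mulrA. Qed.
Fact sa_mul1l : left_id (sa_iota 1) sa_mul.
Proof. by by_eval; rewrite rmorph1 mul1r. Qed.
Fact sa_mul1r : right_id (sa_iota 1) sa_mul.
Proof. by by_eval; rewrite rmorph1 mulr1. Qed.
Fact sa_mulDl : left_distributive sa_mul sa_add.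
Proof. by by_eval; rewrite mulrDl. Qed.
Fact sa_mulDr : right_distributive sa_mul sa_add.
Proof. by by_eval; rewrite mulrDr. Qed.

HB.instance Definition _ := GRing.isZmodule.Build subshift_alg
  sa_addA sa_addC sa_add0 sa_addN.
HB.instance Definition _ := GRing.Zmodule_isPzRing.Build subshift_alg
  sa_mulA sa_mul1l sa_mul1r sa_mulDl sa_mulDr.

Lemma cls_add u v : cls (Add u v) = cls u + cls v. Proof. by rewrite -sa_addE. Qed.
Lemma cls_opp u : cls (Opp u) = - cls u. Proof. by rewrite -sa_oppE. Qed.
Lemma cls_mul u v : cls (Mul u v) = cls u * cls v. Proof. by rewrite -sa_mulE. Qed.
Lemma cls_scal0 : cls (Scal 0) = 0. Proof. by []. Qed.
Lemma cls_scal1 : cls (Scal 1) = 1. Proof. by []. Qed.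

Fact sa_iota_is_additive : zmod_morphism sa_iota.
Proof.
move=> r r'; rewrite /sa_iota -cls_opp -cls_add.
by apply/clsP => B iota p s t H /=; rewrite rmorphB.
Qed.
Fact sa_iota_is_monoid : monoid_morphism sa_iota.
Proof.
split=> // r r'; rewrite /sa_iota -cls_mul.
by apply/clsP => B iota p s t H /=; rewrite rmorphM.
Qed.
HB.instance Definition _ :=
  GRing.isZmodMorphism.Build R subshift_alg sa_iota sa_iota_is_additive.
HB.instance Definition _ :=
  GRing.isMonoidMorphism.Build R subshift_alg sa_iota sa_iota_is_monoid.

Definition sa_p (Y : BA X) : subshift_alg := cls (Proj Y).
Definition sa_s (a : A) : subshift_alg := cls (Gen a).
Definition sa_t (a : A) : subshift_alg := cls (GenStar a).

Definition word_expr (f : A -> expr) (w : seq A) : expr :=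
  foldr (fun a => Mul (f a)) (Scal 1) w.

Lemma cls_word f w : cls (word_expr f w) = \prod_(a <- w) cls (f a).
Proof.
elim: w => [|a w IH] /=; first by rewrite big_nil cls_scal1.
by rewrite big_cons cls_mul IH.
Qed.

Lemma eval_word (B : pzRingType) (iota : {rmorphism R -> B}) p s t f w :
  eval iota p s t (word_expr f w) = \prod_(a <- w) eval iota p s t (f a).
Proof.
elim: w => [|a w IH] /=; first by rewrite big_nil rmorph1.
by rewrite big_cons IH.
Qed.

Lemma sa_family : subshift_family sa_iota sa_p sa_s sa_t.
Proof.
split.
- move=> r; elim/cls_ind => u; rewrite -!cls_mul; apply/clsP => B i p s t H /=.
  exact: (sf_central H).
- by apply/clsP => B i p s t H /=; rewrite rmorph1 (sf_p1 H).
- by move=> Y Z; rewrite /sa_p -cls_mul; apply/clsP => B i p s t H /=; rewrite (sf_pI H).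
- move=> Y Z; rewrite /sa_p -cls_opp -(cls_add (Proj Y)) -cls_add; apply/clsP => B i p s t H /=.
  by rewrite (sf_pU H).
- by apply/clsP => B i p s t H /=; rewrite rmorph0 (sf_p0 H).
- move=> a; rewrite /sa_s /sa_t -(cls_mul (Gen a)) -cls_mul.
  by apply/clsP => B i p s t H /=; rewrite (sf_sts H).
- move=> a; rewrite /sa_s /sa_t -(cls_mul (GenStar a)) -cls_mul.
  by apply/clsP => B i p s t H /=; rewrite (sf_tst H).
- move=> al be hal hbe; rewrite /word_s /word_t /sa_s /sa_t.
  rewrite -(cls_word Gen al) -(cls_word Gen be).
  rewrite -(cls_word GenStar (rev al)) -(cls_word GenStar (rev be)).
  rewrite -(cls_mul (word_expr Gen be)).
  rewrite -(cls_mul _ (word_expr Gen al)) -(cls_mul _ (word_expr GenStar _)).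
  by apply/clsP => B i p s t H /=; rewrite !eval_word -(sf_C H).
Qed.

Section Universal.
Variables (B : pzRingType) (iota : {rmorphism R -> B}).
Variables (p : BA X -> B) (s t : A -> B).

Lemma subshift_alg_lift : subshift_family iota p s t ->
  exists f : {rmorphism subshift_alg -> B},
    [/\ forall r, f (sa_iota r) = iota r, forall Y, f (sa_p Y) = p Y,
        forall a, f (sa_s a) = s a & forall a, f (sa_t a) = t a].
Proof.
move=> H; pose f (x : subshift_alg) := eval iota p s t (repr x).
have fE u : f (cls u) = eval iota p s t u by exact: repr_cls.
have fB : zmod_morphism f.
  by elim/cls_ind=> u; elim/cls_ind=> v; rewrite -cls_opp -cls_add !fE.
have fM : monoid_morphism f.
  split; first by rewrite -cls_scal1 fE /= rmorph1.
  by elim/cls_ind=> u; elim/cls_ind=> v; rewrite -cls_mul !fE.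
pose zM := GRing.isZmodMorphism.Build subshift_alg B f fB.
pose mM := GRing.isMonoidMorphism.Build subshift_alg B f fM.
pose F : {rmorphism subshift_alg -> B} := HB.pack f zM mM.
by exists F; split=> *; exact: fE.
Qed.

Lemma subshift_alg_unique (f g : {rmorphism subshift_alg -> B}) :
  (forall r, f (sa_iota r) = g (sa_iota r)) ->
  (forall Y, f (sa_p Y) = g (sa_p Y)) ->
  (forall a, f (sa_s a) = g (sa_s a)) ->
  (forall a, f (sa_t a) = g (sa_t a)) -> f =1 g.
Proof.
move=> hr hp hs ht; elim/cls_ind => u; elim: u => //= [u hu v hv|u hu|u hu v hv].
- by rewrite cls_add !rmorphD /= hu hv.
- by rewrite cls_opp !rmorphN /= hu.
- by rewrite cls_mul !rmorphM /= hu hv.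
Qed.

End Universal.

End SubshiftAlgebra.

(* Main.v *)
(* Let b be a non-zero element of the radical, so that 1 - h is invertible for all
   h in the ideal generated by b.  The subshift algebra acts on functions on X with
   values in a module carrying an action of Z that records the degree: s_a shifts,
   t_a prepends the letter a, p_Y multiplies by the indicator function of Y.  With
   values in the algebra itself this action is faithful on the part generated by the
   p_Y and the letters of the language ([simulates_faithful]).

   If all letters occur in the language, the value at a point y of b acting on f is a
   finite sum of r_j w^(k_j) f(x_j) with the x_j in the orbit of y, w being the
   action of 1 in Z.  Cutting down to one orbit point and moving back to y gives h in
   the ideal of b acting at y as a non-zero Laurent polynomial g(w), and w can be
   taken to be an invertible matrix with g(w) = 1.  Then 1 - h is not invertible.

   A letter a outside of the language satisfies only s_a t_a s_a = s_a and
   t_a s_a t_a = t_a.  The functions are mapped linearly back to the algebra by some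
   pi with pi (c (diag v)) = c v, so a can act by s_a' = diag (s_a pi(-)), which makes
   the action faithful on the whole algebra.  Such an action may be altered by an
   operator of rank one in high degrees without changing the action of b on a vector
   q0 of low degree; the alteration is chosen to bring b q0 back to q0, so that
   (1 - c b) q0 = 0 for some c. *)

Require Import Defs.
From HB Require Import structures.
From mathcomp Require Import all_boot all_order all_algebra zify.
From mathcomp Require Import boolp classical_sets functions.

Set Implicit Arguments.
Unset Strict Implicit.
Unset Printing Implicit Defensive.

Import Order.TTheory GRing.Theory Num.Theory.
Local Open Scope classical_set_scope.
Local Open Scope ring_scope.

(** * The Jacobson radical *)

Section JacobsonRadical.
Variable S : pzRingType.

Definition left_ideal (N : set S) : Prop :=
  [/\ N 0, forall x y, N x -> N y -> N (x + y) & forall a x, N x -> N (a * x)].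

Section LeftQuotient.
Variables (N : set S) (idN : left_ideal N).

Definition left_ideal_pred : {pred S} := fun x => `[< N x >].

Fact left_ideal_zmod_closed : zmod_closed left_ideal_pred.
Proof.
case: idN => N0 ND NM; split; first exact/asboolP.
move=> x y /asboolP Nx /asboolP Ny; apply/asboolP.
by rewrite -[y]mul1r -mulNr; apply: ND => //; apply: NM.
Qed.
HB.instance Definition _ :=
  GRing.isZmodClosed.Build S left_ideal_pred left_ideal_zmod_closed.

Definition left_quotient := Quotient.quot left_ideal_pred.
HB.instance Definition _ := GRing.Zmodule.on left_quotient.

Definition quo (x : S) : left_quotient := (\pi_(Quotient.quot left_ideal_pred) x)%qT.

Lemma quo_eq x y : quo x = quo y <-> N (x - y).
Proof.
split=> [/eqP|Nxy].
  by rewrite /quo -Quotient.idealrBE => /asboolP.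
by apply/eqP; rewrite /quo -Quotient.idealrBE; apply/asboolP.
Qed.

Lemma quo_eq0 x : quo x = 0 <-> N x.
Proof. by rewrite -[0](_ : quo 0 = 0) ?quo_eq ?subr0 // /quo raddf0. Qed.

Lemma quoD x y : quo (x + y) = quo x + quo y.
Proof. exact: raddfD. Qed.

Lemma quo_surj (q : left_quotient) : exists x, q = quo x.
Proof. by exists (repr q); rewrite /quo reprK. Qed.

Definition quo_scale (a : S) (q : left_quotient) : left_quotient :=
  quo (a * repr q).

Lemma quo_scaleE a x : quo_scale a (quo x) = quo (a * x).
Proof.
apply/quo_eq; rewrite -mulrBr; have [_ _ NM] := idN; apply: NM.
by apply/quo_eq; rewrite /quo reprK.
Qed.

Fact quo_scaleA a b q : quo_scale a (quo_scale b q) = quo_scale (a * b) q.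
Proof. by have [x ->] := quo_surj q; rewrite !quo_scaleE mulrA. Qed.
Fact quo_scale1 : left_id 1 quo_scale.
Proof. by move=> q; have [x ->] := quo_surj q; rewrite quo_scaleE mul1r. Qed.
Fact quo_scaleDr : right_distributive quo_scale +%R.
Proof.
move=> a q r; have [x ->] := quo_surj q; have [y ->] := quo_surj r.
by rewrite -quoD !quo_scaleE mulrDr quoD.
Qed.
Fact quo_scaleDl q : {morph quo_scale^~ q : a b / a + b}.
Proof.
by move=> a b /=; have [x ->] := quo_surj q; rewrite !quo_scaleE mulrDl quoD.
Qed.

Definition left_quotient_lmod : lmodType S :=
  HB.pack left_quotient
    (GRing.Zmodule_isLmodule.Build S left_quotient
       quo_scaleA quo_scale1 quo_scaleDr quo_scaleDl).

End LeftQuotient.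

Lemma maximal_left_ideal (N : set S) : left_ideal N -> ~ N 1 ->
  exists N', [/\ left_ideal N', N `<=` N', ~ N' 1 &
    forall L, left_ideal L -> N' `<=` L -> ~ L 1 -> L = N'].
Proof.
move=> idN N1.
(* [Zorn_bigcup] also asks for the union of the empty chain, which is empty; so the candidates are
   sets L whose union with N is a left ideal. *)
pose P : set (set S) := [set L | left_ideal (N `|` L) /\ ~ L 1].
have [F FP totF|L [[idL L1] maxL]] := @Zorn_bigcup S P.
  have NFE : forall x, (N `|` \bigcup_(L in F) L) x -> N x \/ exists2 L, F L & L x.
    by move=> x [?|[L FL Lx]]; [left | right; exists L].
  split; last by move=> [L /FP[_ L1] /L1].
  have idF L : F L -> left_ideal (N `|` L) by move=> /FP[].
  split; first by left; case: idN.
  - move=> x y /NFE[Nx|[L FL Lx]] /NFE[Ny|[L' FL' L'y]].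
    + by left; case: idN => _ + _; apply.
    + have [_ ND _] := idF _ FL'.
      have [?|?] := ND x y (or_introl Nx) (or_intror L'y); first by left.
      by right; exists L'.
    + have [_ ND _] := idF _ FL.
      have [?|?] := ND x y (or_intror Lx) (or_introl Ny); first by left.
      by right; exists L.
    + have [LL'|L'L] := totF _ _ FL FL'.
        have [_ ND _] := idF _ FL'.
        have [?|?] := ND x y (or_intror (LL' _ Lx)) (or_intror L'y); first by left.
        by right; exists L'.
      have [_ ND _] := idF _ FL.
      have [?|?] := ND x y (or_intror Lx) (or_intror (L'L _ L'y)); first by left.
      by right; exists L.
  - move=> a x /NFE[Nx|[L FL Lx]].
      by left; case: idN => _ _; apply.
    have [_ _ NM] := idF _ FL.
    have [?|?] := NM a x (or_intror Lx); first by left.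
    by right; exists L.
exists (N `|` L); split=> //; first by case.
move=> L' idL' sL' L'1; apply/seteqP; split=> // x L'x.
apply: contrapT => nx; apply: (maxL L').
  split; first by move=> y Ly; apply: sL'; right.
  by move=> sL'L; apply: nx; right; apply: sL'L.
split=> //; suff -> : N `|` L' = L' by [].
by apply/seteqP; split=> [y [?|]//|y]; [apply: sL'; left | right].
Qed.

(** The preimage L in S of a submodule is a left ideal containing N. Either it contains 1 and the
    submodule is everything, or maximality gives L = N. *)
Lemma left_quotient_simple (N : set S) (idN : left_ideal N) :
    ~ N 1 -> (forall L, left_ideal L -> N `<=` L -> ~ L 1 -> L = N) ->
  simple_module (left_quotient_lmod idN).
Proof.
move=> N1 maxN; split; first by exists (quo idN 1) => /quo_eq0.
move=> P [P0 Plin].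
pose L : set S := [set x | quo idN x \in P].
have idL : left_ideal L.
  split; rewrite /L /=.
  - by rewrite (_ : quo idN 0 = 0) //; apply/quo_eq0; have [] := idN.
  - move=> x y Px Py; rewrite quoD.
    by have := Plin 1 _ _ Px Py; rewrite scale1r.
  - move=> a x Px; have := Plin a _ _ Px P0.
    by rewrite addr0 -(quo_scaleE idN).
have sNL : N `<=` L by move=> x /(quo_eq0 idN) qx; rewrite /L /= qx.
have [L1|L1] := pselect (L 1); [right|left] => m; have [x ->] := quo_surj m.
  by have [_ _ LM] := idL; have := LM x _ L1; rewrite mulr1.
by move=> Lx; apply/quo_eq0; rewrite -(maxN L).
Qed.

(** Without a left inverse of 1 - b, the left ideal S(1 - b) lies in a maximal left ideal N'. As b
    annihilates the simple module S/N', it lies in N', and so does 1 = (1 - b) + b. *)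
Lemma jacobson_quasiregular (b : S) :
  jacobson_radical b -> exists v, v * (1 - b) = 1.
Proof.
move=> Jb; apply: contrapT => nv.
pose N : set S := [set x | exists v, x = v * (1 - b)].
have idN : left_ideal N.
  split; first by exists 0; rewrite mul0r.
  - by move=> _ _ [v ->] [v' ->]; exists (v + v'); rewrite mulrDl.
  - by move=> a _ [v ->]; exists (a * v); rewrite mulrA.
have N1 : ~ N 1 by move=> [v v1]; apply: nv; exists v.
have [N' [idN' sNN' N'1 maxN']] := maximal_left_ideal idN N1.
have simM := left_quotient_simple idN' N'1 maxN'.
have /(_ (quo idN' 1)) : forall m : left_quotient_lmod idN', b *: m = 0.
  exact: (Jb _ (ex_intro _ _ (conj simM erefl))).
rewrite [LHS](quo_scaleE idN') mulr1 => /quo_eq0 N'b.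
apply: N'1; rewrite -(subrK b 1); have [_ ND _] := idN'; apply: ND => //.
by apply: sNN'; exists 1; rewrite mul1r.
Qed.

Lemma jacobsonMl (c b : S) : jacobson_radical b -> jacobson_radical (c * b).
Proof.
move=> Jb I pI; have := Jb _ pI; have [M [_ ->]] := pI => /= bM m.
by rewrite -scalerA bM scaler0.
Qed.

Lemma jacobsonMr (c b : S) : jacobson_radical b -> jacobson_radical (b * c).
Proof.
move=> Jb I pI; have := Jb _ pI; have [M [_ ->]] := pI => /= bM m.
by rewrite -scalerA bM.
Qed.

(** The left inverse v equals 1 + v b = 1 - (- v) b, and (- v) b is again in the radical; so v has a
    left inverse too, which must be 1 - b. *)
Lemma jacobson_invertible (b : S) : jacobson_radical b ->
  exists v, v * (1 - b) = 1 /\ (1 - b) * v = 1.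
Proof.
move=> Jb; have [v v1] := jacobson_quasiregular Jb; exists v; split=> //.
have [w] := jacobson_quasiregular (jacobsonMl (- v) Jb).
rewrite mulNr opprK (_ : 1 + v * b = v).
  move=> wv; suff -> : 1 - b = w by [].
  by rewrite -[RHS]mulr1 -[in RHS]v1 mulrA wv mul1r.
by rewrite -[X in X + _]v1 mulrBr mulr1 subrK.
Qed.

End JacobsonRadical.

(** * Linear algebra *)

Section LinearEndomorphisms.
Variables (R : comPzRingType) (V : lmodType R).

(** The endomorphism ring of V, with composition as product. V may be zero, as happens for functions
    on an empty subshift. *)
Record lend := Lend { lend_fun :> V -> V; lend_linear : linear lend_fun }.

HB.instance Definition _ := gen_eqMixin lend.
HB.instance Definition _ := gen_choiceMixin lend.

Lemma lendP (f g : lend) : f =1 g -> f = g.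
Proof.
case: f g => f fl [g gl] /= /funext fg; case: g / fg gl => gl.
by rewrite (Prop_irrelevance fl gl).
Qed.

Fact lend_zero_linear : linear (fun _ : V => 0 : V).
Proof. by move=> a x y; rewrite scaler0 addr0. Qed.
Fact lend_one_linear : linear (fun x : V => x).
Proof. by []. Qed.
Fact lend_opp_linear (f : lend) : linear (fun x => - f x).
Proof. by move=> a x y; rewrite lend_linear opprD scalerN. Qed.
Fact lend_add_linear (f g : lend) : linear (fun x => f x + g x).
Proof. by move=> a x y; rewrite !lend_linear scalerDr addrACA. Qed.
Fact lend_mul_linear (f g : lend) : linear (fun x => f (g x)).
Proof. by move=> a x y; rewrite !lend_linear. Qed.
Fact lend_scal_linear (r : R) : linear (fun x : V => r *: x).
Proof. by move=> a x y; rewrite scalerDr !scalerA mulrC. Qed.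

Definition lend_zero := Lend lend_zero_linear.
Definition lend_one := Lend lend_one_linear.
Definition lend_opp f := Lend (lend_opp_linear f).
Definition lend_add f g := Lend (lend_add_linear f g).
Definition lend_mul f g := Lend (lend_mul_linear f g).
Definition lend_scal r := Lend (lend_scal_linear r).

Lemma lend0 (f : lend) : f 0 = 0.
Proof. by have := lend_linear f 1 0 0; rewrite !scale1r addr0 -{1}(addr0 (f 0)) => /addrI. Qed.
Lemma lendD (f : lend) x y : f (x + y) = f x + f y.
Proof. by have := lend_linear f 1 x y; rewrite !scale1r. Qed.
Lemma lendZ (f : lend) r x : f (r *: x) = r *: f x.
Proof. by have := lend_linear f r x 0; rewrite lend0 !addr0. Qed.

Fact lend_addA : associative lend_add.
Proof. by move=> f g h; apply: lendP => x /=; rewrite addrA. Qed.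
Fact lend_addC : commutative lend_add.
Proof. by move=> f g; apply: lendP => x /=; rewrite addrC. Qed.
Fact lend_add0 : left_id lend_zero lend_add.
Proof. by move=> f; apply: lendP => x /=; rewrite add0r. Qed.
Fact lend_addN : left_inverse lend_zero lend_opp lend_add.
Proof. by move=> f; apply: lendP => x /=; rewrite addNr. Qed.
HB.instance Definition _ :=
  GRing.isZmodule.Build lend lend_addA lend_addC lend_add0 lend_addN.

Fact lend_mulA : associative lend_mul.
Proof. by move=> f g h; apply: lendP. Qed.
Fact lend_mul1l : left_id lend_one lend_mul.
Proof. by move=> f; apply: lendP. Qed.
Fact lend_mul1r : right_id lend_one lend_mul.
Proof. by move=> f; apply: lendP. Qed.
Fact lend_mulDl : left_distributive lend_mul lend_add.
Proof. by move=> f g h; apply: lendP. Qed.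
Fact lend_mulDr : right_distributive lend_mul lend_add.
Proof. by move=> f g h; apply: lendP => x /=; rewrite lendD. Qed.
HB.instance Definition _ := GRing.Zmodule_isPzRing.Build lend
  lend_mulA lend_mul1l lend_mul1r lend_mulDl lend_mulDr.

Lemma lendME (f g : lend) x : (f * g) x = f (g x). Proof. by []. Qed.
Lemma lendDE (f g : lend) x : (f + g) x = f x + g x. Proof. by []. Qed.
Lemma lendNE (f : lend) x : (- f) x = - f x. Proof. by []. Qed.
Lemma lend1E x : (1 : lend) x = x. Proof. by []. Qed.

Fact lend_scal_is_zmod : zmod_morphism lend_scal.
Proof. by move=> r r'; apply: lendP => x /=; rewrite scalerBl. Qed.
Fact lend_scal_is_monoid : monoid_morphism lend_scal.
Proof.
by split=> [|r r']; apply: lendP => x /=; [rewrite scale1r | rewrite scalerA].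
Qed.
HB.instance Definition _ :=
  GRing.isZmodMorphism.Build R lend lend_scal lend_scal_is_zmod.
HB.instance Definition _ :=
  GRing.isMonoidMorphism.Build R lend lend_scal lend_scal_is_monoid.

End LinearEndomorphisms.

(** * Extension of partially defined linear maps *)

Section LinearExtension.
Variables (K : fieldType) (V U : lmodType K).

Definition linear_relation (G : set (V * U)) : Prop :=
  G (0, 0) /\ forall a p q, G p -> G q -> G (a *: p.1 + q.1, a *: p.2 + q.2).

(** Zorn's lemma on graphs of partial linear maps containing G. A maximal one is defined everywhere,
    since a vector v outside of its domain could be sent to 0. *)
Lemma linear_extension (G : set (V * U)) :
    linear_relation G -> (forall u, G (0, u) -> u = 0) ->
  exists f : V -> U, linear f /\ forall p, G p -> f p.1 = p.2.
Proof.
move=> linG funG.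
pose P : set (set (V * U)) := [set H | linear_relation (G `|` H) /\
  forall u, (G `|` H) (0, u) -> u = 0].
have [F FP totF|H [[linH funH] maxH]] := @Zorn_bigcup _ P.
  have GFE p : (G `|` \bigcup_(L in F) L) p -> G p \/ exists2 L, F L & L p.
    by move=> [?|[L FL Lp]]; [left | right; exists L].
  split; last first.
    move=> u /GFE[/funG//|[L FL Lu]].
    by have [_] := FP _ FL; apply; right.
  split; first by left; case: linG.
  have aux L a p q : F L -> (G `|` L) p -> (G `|` L) q ->
    (G `|` \bigcup_(L in F) L) (a *: p.1 + q.1, a *: p.2 + q.2).
    move=> FL Lp Lq; have [[_ linL] _] := FP _ FL.
    by have [?|?] := linL a _ _ Lp Lq; [left | right; exists L].
  move=> a p q /GFE[Gp|[L FL Lp]] /GFE[Gq|[L' FL' Lq]].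
  - by left; apply: linG.2.
  - by apply: (aux L') => //; [left|right].
  - by apply: (aux L) => //; [right|left].
  - have [LL'|L'L] := totF _ _ FL FL'.
      by apply: (aux L') => //; right=> //; apply: LL'.
    by apply: (aux L) => //; right=> //; apply: L'L.
set G' := G `|` H in linH funH.
have uniqG' v u u' : G' (v, u) -> G' (v, u') -> u = u'.
  move=> Gu Gu'; apply/eqP; rewrite eq_sym -subr_eq0; apply/eqP/funH.
  by have := linH.2 (-1) _ _ Gu Gu'; rewrite /= !scaleN1r addNr addrC.
have totG' v : exists u, G' (v, u).
  apply: contrapT => nv.
  pose H' : set (V * U) := [set p | exists a q, G' q /\ p = (a *: v + q.1, q.2)].
  have sH' : G' `<=` H'.
    by move=> [x u] Gxu; exists 0, (x, u); rewrite scale0r add0r.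
  have H'v : H' (v, 0).
    by exists 1, (0, 0); split; [exact: linH.1 | rewrite scale1r addr0].
  apply: (maxH H').
    split; first by move=> p Hp; apply: sH'; right.
    move=> sH'H; apply: nv; exists 0; right; exact: sH'H.
  rewrite /P /mkset; have -> : G `|` H' = H'.
    by apply/seteqP; split=> [p [Gp|]//|p]; [apply: sH'; left | right].
  split.
    split; first exact: sH' linH.1.
    move=> a _ _ [b [q [Gq ->]]] [b' [q' [Gq' ->]]].
    exists (a * b + b'), (a *: q.1 + q'.1, a *: q.2 + q'.2).
    split; first exact: linH.2.
    by rewrite /= scalerDr scalerA scalerDl addrACA.
  move=> u [a [[x u'] [Gxu [E ->]]]] /=.
  have [a0|a0] := eqVneq a 0.
    by apply: funH; move: E Gxu; rewrite a0 scale0r add0r => <-.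
  (* For non-zero a, the vector v is a multiple of x and so already in the domain. *)
  case: nv; exists (- a^-1 *: u').
  have := linH.2 (- a^-1) _ _ Gxu linH.1.
  rewrite /= !addr0 (_ : - a^-1 *: x = v) //.
  have /eqP := esym E; rewrite addr_eq0 => /eqP/(congr1 ( *:%R (a^-1))).
  by rewrite scalerA mulVf // scale1r => ->; rewrite scalerN scaleNr.
have [f fG'] := choice totG'.
exists f; split=> [a x y|[x u] Gp]; last by apply: (uniqG' x) => //; left.
apply: (uniqG' (a *: x + y)) => //; first exact: linH.2 (fG' x) (fG' y).
Qed.

End LinearExtension.

(** The coordinate on the line spanned by v, extended to V. *)
Lemma dual_vector (K : fieldType) (V : lmodType K) (v : V) : v != 0 ->
  exists f : V -> K^o, linear f /\ f v = 1.
Proof.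
move=> v0; pose G : set (V * K^o) := [set p | p.1 = p.2 *: v].
have [||f [flin fG]] := @linear_extension K V K^o G.
- split; first by rewrite /G /= scale0r.
  by move=> a [x r] [y s]; rewrite /G /= => -> ->; rewrite scalerDl scalerA.
- move=> r; rewrite /G /= => /esym/eqP.
  by rewrite scaler_eq0 (negPf v0) orbF => /eqP.
by exists f; split=> //; rewrite (fG (v, 1)) // /G /= scale1r.
Qed.

(** * Words, sequences and the Boolean algebra *)

Section Words.
Variables (A : Type) (X : set (nat -> A)) (hX : subshift X).
Implicit Types (a b : A) (al be w : seq A) (x y : nat -> A) (Y Z : BA X).

Definition shift x : nat -> A := fun n => x n.+1.

Lemma concat0 x : concat [::] x = x.
Proof. by apply/funext => n; rewrite /concat subn0. Qed.

Lemma concat1S a x n : concat [:: a] x n.+1 = x n.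
Proof. by rewrite /concat /= subSS subn0. Qed.

Lemma shift_concat1 a x : shift (concat [:: a] x) = x.
Proof. by apply/funext => n; rewrite /shift concat1S. Qed.

Lemma concat1_shift x : concat [:: x 0%N] (shift x) = x.
Proof. by apply/funext => -[|n] //; rewrite concat1S. Qed.

Lemma concat_cons a w x : concat (a :: w) x = concat [:: a] (concat w x).
Proof.
apply/funext => -[|n] //; rewrite concat1S /concat /= ltnS subSS.
by case: ifP => // h; apply: set_nth_default.
Qed.

Lemma concat_cat al be x : concat (al ++ be) x = concat al (concat be x).
Proof. by elim: al => [|a al IH]; rewrite ?concat0 // cat_cons concat_cons IH -concat_cons. Qed.

Lemma concat1_inj a b x y : concat [:: a] x = concat [:: b] y -> a = b /\ x = y.
Proof.
move=> e; split; first by have := congr1 (@^~ 0%N) e.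
by rewrite -(shift_concat1 a x) e shift_concat1.
Qed.

Lemma concat_inj al be x : size al = size be -> concat al x = concat be x -> al = be.
Proof.
elim: al be => [|a al IH] [|b be] //= [sz].
by rewrite !(concat_cons _ _ x) => /concat1_inj[-> /IH ->].
Qed.

Lemma concat_mkseq x n : concat (mkseq x n) (fun k => x (n + k)%N) = x.
Proof.
apply/funext => k; rewrite /concat size_mkseq.
case: ltnP => kn; first by rewrite nth_mkseq.
by rewrite subnKC.
Qed.

Lemma subshift_shift x : X x -> X (shift x).
Proof.
case: hX => F -> Xx w Fw [i wi]; apply: (Xx w Fw); exists i.+1.
by rewrite -[RHS]wi; apply: eq_mkseq => k; rewrite /shift addSn.
Qed.

Lemma subshift_concat w x : X (concat w x) -> X x.
Proof.
elim: w => [|a w IH]; rewrite ?concat0 // concat_cons => /subshift_shift.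
by rewrite shift_concat1.
Qed.

Lemma language_concat w x : X (concat w x) -> language X w.
Proof.
exists (concat w x) => //; exists 0%N.
apply: (@eq_from_nth _ (x 0%N)); rewrite size_mkseq // => i iw.
by rewrite nth_mkseq // /concat add0n iw.
Qed.

(** Closure of X under the shift moves an occurrence of w to the front. *)
Lemma languageP w : language X w <-> exists x, X (concat w x).
Proof.
split=> [[x Xx [i wi]]|[x]]; last exact: language_concat.
exists (fun k => x (i + (size w + k))%N).
have -> : concat w (fun k => x (i + (size w + k))%N) = fun k => x (i + k)%N.
  rewrite -[RHS](concat_mkseq _ (size w)); congr concat; exact/esym.
apply: (@subshift_concat (mkseq x i)).
by rewrite concat_mkseq.
Qed.

Lemma language_cat al be : language X (al ++ be) -> language X al /\ language X be.
Proof.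
move=> /languageP[x]; rewrite concat_cat => Xx; split; apply/languageP.
  by exists (concat be x).
by exists x; apply: subshift_concat Xx.
Qed.

Lemma language_nil x : X x -> language X [::].
Proof. by move=> Xx; apply/languageP; exists x; rewrite concat0. Qed.

Lemma boolean_algebra_sub S : boolean_algebra X S -> S `<=` X.
Proof.
elim=> [al be _ _ _ [x -> []]//|//|//|Y _ _ x []//|Y Z _ YX _ _ x [] /YX//|].
by move=> Y Z _ YX _ ZX x [/YX|/ZX].
Qed.

Lemma BA_ext Y Z : (forall x, sval Y x <-> sval Z x) -> Y = Z.
Proof.
case: Y Z => S hS [S' hS'] /= SS'.
have {SS'} /esym e : S = S' by apply/seteqP; split=> x /SS'.
by case: S / e hS' hS => hS hS'; rewrite (Prop_irrelevance hS hS').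
Qed.

Lemma BA_sub Y x : sval Y x -> X x.
Proof. by case: Y => S /= hS; apply: boolean_algebra_sub. Qed.

Definition baD Y : BA X := exist _ _ (BA_compl (proj2_sig Y)).

(** The effect on Y of moving p_Y past s_a or t_a, see [p_s] and [t_p]. *)
Definition preset a (S : set (nat -> A)) : set (nat -> A) :=
  [set x | S (concat [:: a] x)].

Lemma preset_C_nil a al :
  preset a (Cset X al [::]) = Cset X (al ++ [:: a]) [::].
Proof.
apply/seteqP; split=> [x [y]|_ [y -> []]]; rewrite /preset /= !concat0.
  move=> <- [Xax Xalax]; exists x; rewrite ?concat0 // concat_cat.
  by split=> //; apply: subshift_concat Xax.
rewrite concat_cat => Xy Xalay; exists (concat [:: a] y); rewrite ?concat0 //.
by split=> //; apply: subshift_concat Xalay.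
Qed.

Lemma preset_C_neq a b al be : a <> b -> preset a (Cset X al (b :: be)) = set0.
Proof.
move=> ab; apply/seteqP; split=> // x [y].
by rewrite (concat_cons b) => /concat1_inj[].
Qed.

Lemma preset_C_eq a al be :
  preset a (Cset X al (a :: be)) = Cset X al be `&` Cset X [:: a] [::].
Proof.
apply/seteqP; split=> [x [y]|_ [[y -> [Xbey Xaly]] [z]]].
  rewrite (concat_cons _ be) => /concat1_inj[_ ->] [Xabey Xaly]; split.
    by exists y => //; split=> //; apply: subshift_concat Xabey.
  by exists (concat be y); rewrite ?concat0 //; split=> //; apply: subshift_concat Xabey.
rewrite !concat0 => <- [_ Xabey]; by exists y; rewrite (concat_cons _ be).
Qed.

Lemma preset_X a : preset a X = Cset X [:: a] [::].
Proof.
apply/seteqP; split=> [x Xax|_ [x -> []]]; rewrite /preset /= ?concat0 //.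
by exists x; rewrite ?concat0 //; split=> //; apply: subshift_concat Xax.
Qed.

Lemma boolean_algebra_C al be : boolean_algebra X (Cset X al be).
Proof.
have [hal|nal] := pselect (language X al); have [hbe|nbe] := pselect (language X be).
- exact: BA_C.
all: suff -> : Cset X al be = set0 by exact: BA_empty.
all: apply/seteqP; split=> // _ [x _ [/language_concat ? /language_concat ?]] //.
Qed.

(** The sets C(al, be) are treated according to the first letter of be. Complements are relative to
    X, hence the intersection with [preset a X] in that case. *)
Lemma boolean_algebra_preset a S :
  boolean_algebra X S -> boolean_algebra X (preset a S).
Proof.
elim=> [al [|b be] _ _||//|Y _ IH|Y Z _ IH _ IH'|Y Z _ IH _ IH'].
- by rewrite preset_C_nil; apply: boolean_algebra_C.
- have [->|ab] := pselect (a = b); last by rewrite preset_C_neq //; apply: BA_empty.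
  by rewrite preset_C_eq; apply: BA_cap; apply: boolean_algebra_C.
- by rewrite preset_X; apply: boolean_algebra_C.
- exact: BA_empty.
- suff -> : preset a (X `\` Y) = preset a X `&` (X `\` preset a Y).
    by apply: BA_cap; [rewrite preset_X; apply: boolean_algebra_C | apply: BA_compl].
  apply/seteqP; split=> [x [Xax nYx]|x [Xax [_ nYx]]] //.
  by split=> //; split=> //; apply: subshift_concat Xax.
- exact: BA_cap.
- exact: BA_cup.
Qed.

Definition baP a Y : BA X := exist _ _ (boolean_algebra_preset a (proj2_sig Y)).

Lemma boolean_algebra_head a : boolean_algebra X [set x | X x /\ x 0%N = a].
Proof.
rewrite (_ : mkset _ = Cset X [::] [:: a]); first exact: boolean_algebra_C.
apply/seteqP; split=> [x [Xx <-]|_ [x -> []]//].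
exists (shift x); rewrite concat1_shift // concat0; split=> //.
exact: subshift_shift.
Qed.

Definition baZ a : BA X := exist _ _ (boolean_algebra_head a).

Fixpoint baZs (w : seq A) : BA X :=
  if w is a :: w' then baU (baZ a) (baZs w') else ba0 X.

End Words.

(** * Consequences of the defining relations in an arbitrary family *)

Section FamilyTheory.
Variables (A : Type) (X : set (nat -> A)) (hX : subshift X) (R : comPzRingType).
Variables (B : pzRingType) (iota : {rmorphism R -> B}).
Variables (p : BA X -> B) (s t : A -> B) (H : subshift_family iota p s t).
Implicit Types (a b : A) (al be w : seq A) (Y Z : BA X).

Local Notation core a := (language X [:: a]).

Lemma p_comm Y Z : p Y * p Z = p Z * p Y.
Proof. by rewrite -!(sf_pI H); congr p; apply: BA_ext => x; split=> -[]. Qed.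

Lemma p_empty Y : (forall x, ~ sval Y x) -> p Y = 0.
Proof. by move=> Y0; rewrite -(sf_p0 H); congr p; apply: BA_ext => x; split=> // /Y0. Qed.

Lemma p_full Y : (forall x, X x -> sval Y x) -> p Y = 1.
Proof.
move=> YX; rewrite -(sf_p1 H); congr p; apply: BA_ext => x; split; last exact: YX.
exact: BA_sub.
Qed.

Lemma p_compl Y : p (baD Y) = 1 - p Y.
Proof.
have := sf_pU H Y (baD Y).
rewrite (p_empty (Y := baI _ _)) => [|x [? []]//].
rewrite subr0 p_full => [->|x Xx /=]; first by rewrite addrC addKr.
by have [|] := pselect (sval Y x); [left | right].
Qed.

Lemma p_sub Y Z : (forall x, sval Y x -> sval Z x) -> p Y * p Z = p Y.
Proof.
move=> YZ; rewrite -(sf_pI H); congr p; apply: BA_ext => x /=.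
by split=> [[]//|Yx]; split=> //; apply: YZ.
Qed.

Lemma word_s_nil : word_s s [::] = 1. Proof. exact: big_nil. Qed.
Lemma word_t_nil : word_t t [::] = 1. Proof. exact: big_nil. Qed.
Lemma word_s_cons a w : word_s s (a :: w) = s a * word_s s w.
Proof. exact: big_cons. Qed.
Lemma word_t_cons a w : word_t t (a :: w) = word_t t w * t a.
Proof. by rewrite /word_t rev_cons big_rcons. Qed.
Lemma word_s1 a : word_s s [:: a] = s a. Proof. exact: big_seq1. Qed.
Lemma word_t1 a : word_t t [:: a] = t a. Proof. exact: big_seq1. Qed.
Lemma word_s_cat al be : word_s s (al ++ be) = word_s s al * word_s s be.
Proof. exact: big_cat. Qed.
Lemma word_t_cat al be : word_t t (al ++ be) = word_t t be * word_t t al.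
Proof. by rewrite /word_t rev_cat big_cat. Qed.

Lemma core_nil a : core a -> language X [::].
Proof. by move=> /(languageP hX)[x /(language_nil hX)]. Qed.

Lemma s_t a : core a -> s a * t a = p (baZ hX a).
Proof.
move=> ca; have := sf_C H (core_nil ca) ca.
rewrite word_s_nil word_t_nil word_s1 word_t1 !mulr1 => ->.
congr p; apply: BA_ext => x /=; split=> [[y -> []]//|[Xx <-]].
exists (shift x); rewrite concat1_shift // concat0; split=> //.
exact: subshift_shift.
Qed.

Lemma t_s a : core a -> t a * s a = p (baP hX a (ba1 X)).
Proof.
move=> ca; have := sf_C H ca (core_nil ca).
rewrite word_s_nil word_t_nil word_s1 word_t1 mul1r mulr1 => ->.
by congr p; apply: BA_ext => x /=; rewrite preset_X.
Qed.

(** Induction over the Boolean algebra. On C(al, be), relation [sf_C] gives the claim if be is empty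
    or starts with a; if the set [preset a] is empty, both sides vanish. *)
Lemma p_s a Y : core a -> p Y * s a = s a * p (baP hX a Y).
Proof.
move=> ca.
have sset Y' Z : (forall x, sval Y' x <-> sval Z x) -> p Y' = p Z.
  by move=> YZ; congr p; apply: BA_ext.
have pp S (h h' : boolean_algebra X S) : p (exist _ _ h) = p (exist _ _ h').
  exact: sset.
suff IH S : boolean_algebra X S -> forall h : boolean_algebra X S,
    p (exist _ S h) * s a = s a * p (baP hX a (exist _ S h)).
  by case: Y => S h; apply: IH.
elim=> [al be hal hbe|||S' hS' IH|S' S'' hS' IH' hS'' IH''
  |S' S'' hS' IH' hS'' IH''] h.
- have Zp0 : (forall x, preset a (Cset X al be) x -> False) ->
    p (exist _ _ h) * s a = s a * p (baP hX a (exist _ _ h)).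
    move=> e; rewrite [p (baP _ _ _)]p_empty // mulr0 -(sf_sts H a) s_t // mulrA -(sf_pI H).
    rewrite p_empty ?mul0r // => x [/= Cx [_ xa]]; apply: (e (shift x)).
    by rewrite /preset /= -xa concat1_shift.
  case: be hbe h Zp0 => [|b be] hbe h Zp0.
    have [hala|nala] := pselect (language X (al ++ [:: a])); last first.
      apply: Zp0 => x; rewrite preset_C_nil // => -[y _ [_ /language_concat]].
      exact: nala.
    have e : p (exist _ _ h) = word_t t al * word_s s al.
      by have := sf_C H hal hbe; rewrite word_s_nil word_t_nil mul1r mulr1 => ->; apply: pp.
    have e' : p (baP hX a (exist _ _ h)) =
        t a * (word_t t al * word_s s al) * s a.
      have := sf_C H hala hbe; rewrite word_s_nil word_t_nil mul1r mulr1.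
      rewrite word_t_cat word_s_cat word_t1 word_s1 !mulrA => ->.
      by apply: sset => x /=; rewrite preset_C_nil.
    by rewrite e' -e !mulrA s_t // p_comm -mulrA -s_t // (sf_sts H).
  have [ab|ab] := pselect (a = b); last first.
    by apply: Zp0 => x; rewrite preset_C_neq.
  case: b / ab hbe h Zp0 => hbe h _.
  have [_ hbe'] := @language_cat _ _ hX [:: a] _ hbe.
  have -> : p (exist _ _ h) =
    s a * (word_s s be * word_t t al * word_s s al * word_t t be) * t a.
    have := sf_C H hal hbe; rewrite word_s_cons word_t_cons !mulrA => ->; exact: pp.
  have -> : p (baP hX a (exist _ _ h)) =
    p (baC hal hbe') * p (baP hX a (ba1 X)).
    by rewrite -(sf_pI H); apply: sset => x /=; rewrite preset_C_eq // preset_X.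
  by rewrite (sf_C H hal hbe') -t_s // !mulrA.
- rewrite (sset _ (ba1 X)) // (sf_p1 H) mul1r (sset _ (baP hX a (ba1 X))) //.
  by rewrite -t_s // mulrA (sf_sts H).
- have e0 Z : sval Z `<=` set0 -> p Z = 0 by move=> Z0; apply: p_empty => x /Z0.
  by rewrite (e0 (exist _ _ h)) ?(e0 (baP _ _ _)) ?mul0r ?mulr0 => // x.
- set Y' : BA X := exist _ _ hS' in IH *; move/(_ hS'): IH => IH.
  rewrite (sset _ (baD Y')) // p_compl mulrBl IH mul1r.
  rewrite (sset (baP hX a (exist _ _ h)) (baI (baP hX a (ba1 X)) (baD (baP hX a Y')))); last first.
    move=> x; split=> [[Xax nY]|]; last by move=> [Xax [_ nY]].
    split=> //; split=> //.
    by apply: (subshift_concat hX (w := [:: a])).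
  by rewrite (sf_pI H) p_compl -t_s // !mulrA (sf_sts H) mulrBr mulr1.
- set Y' : BA X := exist _ _ hS' in IH' *; move/(_ hS'): IH' => IH'.
  set Y'' : BA X := exist _ _ hS'' in IH'' *; move/(_ hS''): IH'' => IH''.
  rewrite (sset _ (baI Y' Y'')) // (sset (baP hX a (exist _ _ h)) (baI (baP hX a Y') (baP hX a Y''))) //.
  by rewrite !(sf_pI H) -mulrA IH'' mulrA IH' mulrA.
- set Y' : BA X := exist _ _ hS' in IH' *; move/(_ hS'): IH' => IH'.
  set Y'' : BA X := exist _ _ hS'' in IH'' *; move/(_ hS''): IH'' => IH''.
  rewrite (sset _ (baU Y' Y'')) // (sset (baP hX a (exist _ _ h)) (baU (baP hX a Y') (baP hX a Y''))) //.
  rewrite !(sf_pU H) !(sf_pI H) mulrBl mulrDl IH' IH'' -mulrA IH'' mulrA IH'.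
  by rewrite mulrBr mulrDr mulrA.
Qed.

(** Insert t_a = t_a s_a t_a, commute p_Y with s_a t_a, which is the projection of a cylinder, and
    apply [p_s]. *)
Lemma t_p a Y : core a -> t a * p Y = p (baP hX a Y) * t a.
Proof.
move=> ca; rewrite -{1}(sf_tst H) -!mulrA (mulrA (s a)) s_t // p_comm -s_t //.
rewrite (mulrA (p Y)) p_s // -mulrA (mulrA (t a)) t_s // mulrA p_comm p_sub //.
by move=> x; apply: (@BA_sub _ _ Y).
Qed.

Lemma t_s_neq a b : core a -> core b -> a <> b -> t a * s b = 0.
Proof.
move=> ca cb ab; rewrite -(sf_tst H) -(sf_sts H b) -!mulrA (mulrA (s a)) s_t //.
rewrite (mulrA (s b)) s_t // (mulrA (p _)) -(sf_pI H) p_empty ?mul0r ?mulr0 //.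
by move=> x [] [_ xa] [_ xb]; apply: ab; rewrite -xa -xb.
Qed.

(** Only the single letters of w have to occur in X, not w itself, so that these words are closed
    under concatenation. *)
Fixpoint core_word w : Prop :=
  if w is a :: w' then core a /\ core_word w' else True.

Lemma p_word_s Y w : core_word w ->
  exists Z, p Y * word_s s w = word_s s w * p Z.
Proof.
elim: w Y => [|a w IH] Y; first by exists Y; rewrite word_s_nil mulr1 mul1r.
move=> [ca cw]; have [Z pZ] := IH (baP hX a Y) cw; exists Z.
by rewrite word_s_cons mulrA p_s // -mulrA pZ mulrA.
Qed.

End FamilyTheory.

(** * Representations on functions on the subshift *)

Section Representation.
Variables (A : Type) (X : set (nat -> A)) (hX : subshift X) (R : comPzRingType).
Implicit Types (a b : A) (al be w : seq A) (x y : nat -> A) (Y Z : BA X).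

Local Notation core a := (language X [:: a]).
Local Notation XT := {x : nat -> A | X x}.
Local Notation alg := (subshift_alg R X).

Record int_action (M : lmodType R) (W : int -> lend M) : Prop := IntAction {
  int_action0 : W 0 = 1;
  int_actionD : forall i j, W (i + j) = W i * W j }.

Section Functions.
Variable M : lmodType R.
Local Notation F := (XT -> M).
Implicit Types f g : F.

(** Extension by zero to all sequences, so that formulas carry no proofs of membership in X. *)
Definition ext f x : M :=
  if pselect (X x) is left h then f (exist _ x h) else 0.

Lemma ext_val f (y : XT) : ext f (sval y) = f y.
Proof.
case: y => x Xx; rewrite /ext /=; case: pselect => // Xx'.
by rewrite (Prop_irrelevance Xx' Xx).
Qed.

Lemma ext_out f x : ~ X x -> ext f x = 0.
Proof. by rewrite /ext; case: pselect. Qed.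

Lemma extP f g : (forall x, X x -> ext f x = ext g x) -> f = g.
Proof. by move=> fg; apply/funext => y; rewrite -!ext_val; apply/fg/svalP. Qed.

Lemma ext_linear x : linear (ext^~ x).
Proof. by move=> r f g; rewrite /ext; case: pselect => // _; rewrite scaler0 addr0. Qed.

Lemma extD f g x : ext (f + g) x = ext f x + ext g x.
Proof. by have := ext_linear x 1 f g; rewrite !scale1r. Qed.
Lemma ext0 x : ext 0 x = 0.
Proof. by rewrite /ext; case: pselect. Qed.
Lemma extZ r f x : ext (r *: f) x = r *: ext f x.
Proof. by have := ext_linear x r f 0; rewrite ext0 !addr0. Qed.

Definition mk (G : (nat -> A) -> M) : F := fun z => G (sval z).

Lemma ext_mk G x : X x -> ext (mk G) x = G x.
Proof. by rewrite /ext /mk; case: pselect. Qed.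

End Functions.

(** * The representation by shifting and prepending *)

Section Model.
Variables (M : lmodType R) (W : int -> lend M) (hW : int_action W).
Local Notation F := (XT -> M).
Implicit Types f : F.

Definition mp_fun Y f : F := mk (fun x => if `[< sval Y x >] then ext f x else 0).
Definition ms_fun a f : F :=
  mk (fun x => if `[< x 0%N = a >] then W 1 (ext f (shift x)) else 0).
Definition mt_fun a f : F := mk (fun x => W (-1) (ext f (concat [:: a] x))).

Fact mp_linear Y : linear (mp_fun Y).
Proof.
move=> r f g; apply: extP => x Xx; rewrite ext_linear !ext_mk //.
by case: ifP => _; rewrite ?ext_linear // scaler0 addr0.
Qed.
Fact ms_linear a : linear (ms_fun a).
Proof.
move=> r f g; apply: extP => x Xx; rewrite ext_linear !ext_mk //.
by case: ifP => _; rewrite ?ext_linear ?lend_linear // scaler0 addr0.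
Qed.
Fact mt_linear a : linear (mt_fun a).
Proof.
move=> r f g; apply: extP => x Xx; rewrite ext_linear !ext_mk //.
by rewrite ext_linear lend_linear.
Qed.

Definition mp Y := Lend (mp_linear Y).
Definition ms a := Lend (ms_linear a).
Definition mt a := Lend (mt_linear a).

Lemma mpE Y f x : ext (mp Y f) x = if `[< sval Y x >] then ext f x else 0.
Proof.
have [Xx|nXx] := pselect (X x); first by rewrite ext_mk.
by rewrite !ext_out //; case: ifP.
Qed.

Lemma msE a f x : ext (ms a f) (concat [:: a] x) =
  if `[< X (concat [:: a] x) >] then W 1 (ext f x) else 0.
Proof.
case: asboolP => Xx; last by rewrite ext_out.
by rewrite ext_mk // shift_concat1 asboolT.
Qed.

Lemma msE_neq a f x : x 0%N <> a -> ext (ms a f) x = 0.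
Proof.
move=> xa; have [Xx|nXx] := pselect (X x); last by rewrite ext_out.
by rewrite ext_mk // asboolF.
Qed.

Lemma mtE a f x : X x -> ext (mt a f) x = W (-1) (ext f (concat [:: a] x)).
Proof. by move=> Xx; rewrite ext_mk. Qed.

(** A letter outside of the language occurs in no instance of [sf_C], so any pair g, h with the two
    relations below may stand for it and its star. *)
Variables (g h : A -> lend F).
Hypotheses (ghg : forall a, g a * h a * g a = g a).
Hypotheses (hgh : forall a, h a * g a * h a = h a).

Definition rs a : lend F := if `[< core a >] then ms a else g a.
Definition rt a : lend F := if `[< core a >] then mt a else h a.

Lemma language_core a w : language X (a :: w) -> core a /\ language X w.
Proof. by move=> /(language_cat hX (al := [:: a])). Qed.

Lemma int_action_comp i j (m : M) : W i (W j m) = W (i + j) m.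
Proof. by rewrite (int_actionD hW). Qed.

Lemma int_actionK i (m : M) : W i (W (- i) m) = m.
Proof. by rewrite int_action_comp subrr (int_action0 hW). Qed.

Lemma rs_wordE w f x : language X w -> ext (word_s rs w f) (concat w x) =
  if `[< X (concat w x) >] then W (size w)%:Z (ext f x) else 0.
Proof.
elim: w => [|a w IH] lw; rewrite ?word_s_nil.
  rewrite concat0 (int_action0 hW) lend1E; case: asboolP => // nX.
  by rewrite ext_out.
have [ca lw'] := language_core lw.
rewrite word_s_cons lendME {1}/rs asboolT // concat_cons msE.
case: asboolP => // Xawx; rewrite IH //.
rewrite asboolT; last exact: (subshift_concat hX (w := [:: a])).
by rewrite int_action_comp.
Qed.

Lemma rs_word_out w f x : language X w -> (forall y, x <> concat w y) ->
  ext (word_s rs w f) x = 0.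
Proof.
elim: w x => [|a w IH] x lw nx; first by have := nx x; rewrite concat0.
have [ca lw'] := language_core lw.
rewrite word_s_cons lendME {1}/rs asboolT //.
have [xa|] := pselect (x 0%N = a); last exact: msE_neq.
rewrite -(concat1_shift x) xa msE IH // ?lend0; first by case: ifP.
by move=> y xy; apply: (nx y); rewrite concat_cons -xy -xa concat1_shift.
Qed.

Lemma rt_wordE w f x : language X w -> X x -> ext (word_t rt w f) x =
  W (- (size w)%:Z) (ext f (concat w x)).
Proof.
elim: w f => [|a w IH] f lw Xx; rewrite ?word_t_nil.
  by rewrite concat0 oppr0 (int_action0 hW).
have [ca lw'] := language_core lw.
rewrite word_t_cons lendME IH // {1}/rt asboolT // concat_cons.
have [Xwx|nX] := pselect (X (concat w x)).
  by rewrite mtE // int_action_comp -opprD -PoszD addn1.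
rewrite !ext_out ?lend0 // => Xawx; apply: nX.
exact: (subshift_concat hX (w := [:: a])).
Qed.

Lemma model_family : subshift_family (lend_scal F) mp rs rt.
Proof.
split.
- by move=> r b; apply: lendP => f; rewrite !lendME /= lendZ.
- apply: lendP => f; apply: extP => x Xx; rewrite mpE /= asboolT //.
- move=> Y Z; apply: lendP => f; apply: extP => x Xx; rewrite lendME !mpE /=.
  by rewrite asbool_and; case: `[< sval Y x >].
- move=> Y Z; apply: lendP => f; apply: extP => x Xx.
  rewrite !lendDE lendNE !extD -scaleN1r extZ !mpE /= asbool_and asbool_or scaleN1r.
  by case: `[< _ >]; case: `[< _ >]; rewrite /= ?(addr0, add0r, subr0, oppr0, addrK).
- by apply: lendP => f; apply: extP => x Xx; rewrite mpE /= asboolF // ext0.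
- move=> a; rewrite /rs /rt; case: asboolP => ca; last exact: ghg.
  apply: lendP => f; apply: extP => x Xx; rewrite !lendME.
  have [xa|] := pselect (x 0%N = a); last by move=> xa; rewrite !msE_neq.
  have {xa} e : x = concat [:: a] (shift x) by rewrite -xa concat1_shift.
  move: (shift x) e => z e; rewrite {x}e in Xx *.
  have Xz : X z by apply: (subshift_concat hX (w := [:: a])).
  by rewrite !msE !asboolT // mtE // msE asboolT // int_actionK.
- move=> a; rewrite /rs /rt; case: asboolP => ca; last exact: hgh.
  apply: lendP => f; apply: extP => x Xx; rewrite !lendME !mtE //.
  case: (pselect (X (concat [:: a] x))) => [Xax|nX]; last by rewrite !ext_out.
  by rewrite msE asboolT // mtE // int_actionK.
(* At x = be y the product runs from be y to y, to al y and back, and the degrees cancel; it is zero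
   if al y is not in X. At other points x both sides vanish. *)
- move=> al be hal hbe; apply: lendP => f; apply: extP => x Xx.
  rewrite !lendME mpE /=.
  case: (pselect (exists y, x = concat be y)) => [[y xy]|nxy]; last first.
    rewrite rs_word_out // => [|y xy]; last by apply: nxy; exists y.
    by rewrite asboolF // => -[y xy]; case: nxy; exists y.
  have Xy : X y by apply: (subshift_concat hX (w := be)); rewrite -xy.
  rewrite {1}xy rs_wordE // asboolT -?xy // rt_wordE //.
  rewrite rs_wordE //; case: asboolP => Xaly; last first.
    rewrite !lend0 asboolF // => -[y']; rewrite xy => yy' [_ Xaly'].
    suff e : y = y' by rewrite e in Xaly.
    apply/funext => n; have := congr1 (@^~ (size be + n)%N) yy'.
    by rewrite /concat ltnNge leq_addr /= addKn.
  rewrite asboolT; last by exists y => //; rewrite -xy.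
  by rewrite rt_wordE // !int_action_comp addrNK subrr (int_action0 hW) -xy.
Qed.

Definition model_rep : {rmorphism alg -> lend F} :=
  sval (cid (subshift_alg_lift model_family)).

Lemma model_rep_iota r f : model_rep (sa_iota X r) f = r *: f.
Proof. by rewrite /model_rep; case: cid => /= rep [-> _ _ _]. Qed.

Lemma model_rep_p Y : model_rep (sa_p R Y) = mp Y.
Proof. by rewrite /model_rep; case: cid => /= rep []. Qed.

Lemma model_rep_s a : model_rep (sa_s R X a) = rs a.
Proof. by rewrite /model_rep; case: cid => /= rep []. Qed.

Lemma model_rep_t a : model_rep (sa_t R X a) = rt a.
Proof. by rewrite /model_rep; case: cid => /= rep []. Qed.

Lemma model_rep_word_t w : model_rep (word_t (sa_t R X) w) = word_t rt w.
Proof. by rewrite rmorph_prod; apply: eq_bigr => a _; apply: model_rep_t. Qed.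

End Model.

Section BasicModel.
Variables (M : lmodType R) (W : int -> lend M) (hW : int_action W).
Local Notation F := (XT -> M).

Fact zero_override (S : pzRingType) (a : A) : (0 : S) * 0 * 0 = 0.
Proof. by rewrite mulr0. Qed.

Definition basic_rep : {rmorphism alg -> lend F} :=
  model_rep hW (zero_override (lend F)) (zero_override (lend F)).

Lemma basic_rep_iota r f : basic_rep (sa_iota X r) f = r *: f.
Proof. exact: model_rep_iota. Qed.

Lemma basic_rep_p Y : basic_rep (sa_p R Y) = mp M Y.
Proof. exact: model_rep_p. Qed.

Lemma basic_rep_s a : language X [:: a] -> basic_rep (sa_s R X a) = ms W a.
Proof. by move=> ca; rewrite /basic_rep model_rep_s /rs asboolT. Qed.

Lemma basic_rep_t a : language X [:: a] -> basic_rep (sa_t R X a) = mt W a.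
Proof. by move=> ca; rewrite /basic_rep model_rep_t /rt asboolT. Qed.

(** The formula covers all letters: one outside of the language acts as zero and begins no point of
    X. *)
Lemma basic_rep_sE a f x : X x -> ext (basic_rep (sa_s R X a) f) x =
  if `[< x 0%N = a >] then W 1 (ext f (shift x)) else 0.
Proof.
move=> Xx; rewrite /basic_rep model_rep_s /rs; case: (asboolP (language _ _)) => ca.
  by rewrite ext_mk.
rewrite ext0; case: asboolP => // xa; case: ca; apply/(languageP hX).
by exists (shift x); rewrite -xa concat1_shift.
Qed.

Lemma basic_rep_tE a f x : X x -> ext (basic_rep (sa_t R X a) f) x =
  W (-1) (ext f (concat [:: a] x)).
Proof.
move=> Xx; rewrite /basic_rep model_rep_t /rt; case: asboolP => ca.
  by rewrite ext_mk.
rewrite ext0 ext_out ?lend0 // => Xax; apply: ca.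
by apply/(languageP hX); exists x.
Qed.

Lemma basic_rep_word_t w f x : language X w -> X x ->
  ext (basic_rep (word_t (sa_t R X) w) f) x =
  W (- (size w)%:Z) (ext f (concat w x)).
Proof. by move=> lw Xx; rewrite /basic_rep model_rep_word_t rt_wordE. Qed.

End BasicModel.
End Representation.

(** * Faithfulness on the part generated by the letters of the language *)

Section AlgebraModule.
Variables (R : comPzRingType) (A : Type) (X : set (nat -> A)).
Local Notation alg := (subshift_alg R X).

Definition alg_scale (r : R) (x : alg) : alg := sa_iota X r * x.

Fact alg_scaleA r r' x : alg_scale r (alg_scale r' x) = alg_scale (r * r') x.
Proof. by rewrite /alg_scale mulrA -rmorphM. Qed.
Fact alg_scale1 : left_id 1 alg_scale.
Proof. by move=> x; rewrite /alg_scale rmorph1 mul1r. Qed.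
Fact alg_scaleDr : right_distributive alg_scale +%R.
Proof. by move=> r x y; rewrite /alg_scale mulrDr. Qed.
Fact alg_scaleDl x : {morph alg_scale^~ x : r r' / r + r'}.
Proof. by move=> r r' /=; rewrite /alg_scale rmorphD mulrDl. Qed.

HB.instance Definition _ := GRing.Zmodule_isLmodule.Build R alg
  alg_scaleA alg_scale1 alg_scaleDr alg_scaleDl.

Lemma alg_scaleE (r : R) (x : alg) : r *: x = sa_iota X r * x.
Proof. by []. Qed.

Lemma alg_scaleMr (r : R) (x y : alg) : x * (r *: y) = r *: (x * y).
Proof. by rewrite !alg_scaleE mulrA -(sf_central (sa_family R X)) mulrA. Qed.

End AlgebraModule.

Section Faithful.
Variables (A : Type) (X : set (nat -> A)) (hX : subshift X) (R : comPzRingType).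
Implicit Types (a b : A) (al be w : seq A) (x y : nat -> A) (Y Z : BA X).

Local Notation core a := (language X [:: a]).
Local Notation XT := {x : nat -> A | X x}.
Local Notation alg := (subshift_alg R X).
Local Notation p := (sa_p R).
Local Notation s := (sa_s R X).
Local Notation t := (sa_t R X).
Local Notation H := (sa_family R X).
Local Notation M := (int * (nat -> A) -> alg).
Local Notation Q := (XT -> M).
Implicit Types (v : alg) (q : Q).

Definition degree_shift_fun (i : int) (m : M) : M := fun k => m (k.1 + i, k.2).
Fact degree_shift_linear i : linear (degree_shift_fun i).
Proof. by []. Qed.
Definition degree_shift i := Lend (degree_shift_linear i).

Lemma degree_shift_action : int_action degree_shift.
Proof.
split=> [|i j]; apply: lendP => m; apply/funext => -[k x].
  by rewrite /= /degree_shift_fun addr0.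
by rewrite /= /degree_shift_fun /= -addrA (addrC i).
Qed.

Lemma degree_shiftE i (m : M) k x : degree_shift i m (k, x) = m (k + i, x).
Proof. by []. Qed.

(** The value at y is labelled by degree 0 and by y itself. After an operator has acted, the index
    (k, x) of an entry records the orbit point x from which it came and minus the degree of the
    move. *)
Definition diag_fun v : Q := mk (fun y k => if `[< k = (0, y) >] then v else 0).
Fact diag_linear : linear diag_fun.
Proof.
move=> r v v'; apply/funext => y; apply/funext => k; rewrite /diag_fun /mk.
change ((if `[< k = (0, sval y) >] then r *: v + v' else 0) =
  r *: (if `[< k = (0, sval y) >] then v else 0) +
  (if `[< k = (0, sval y) >] then v' else 0)).
by case: ifP => // _; rewrite scaler0 addr0.
Qed.

Lemma diagZ r v : diag_fun (r *: v) = r *: diag_fun v.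
Proof.
have := diag_linear r v 0; rewrite addr0 => ->.
rewrite -[RHS]addr0; congr (_ + _); apply/funext => y; apply/funext => k.
by rewrite /diag_fun /mk; case: ifP.
Qed.

Lemma diag0 : diag_fun 0 = 0.
Proof. by rewrite -[X in diag_fun X](scale0r 0) diagZ scale0r. Qed.

Lemma diagE v x k y : X x ->
  ext (diag_fun v) x (k, y) = if `[< k = 0 /\ y = x >] then v else 0.
Proof.
move=> Xx; rewrite ext_mk //; congr (if _ then _ else _).
by apply/asboolP/asboolP => [[-> ->]|[-> ->]].
Qed.

Definition rho : {rmorphism alg -> lend Q} := basic_rep hX degree_shift_action.

Local Notation ws := (word_s s).
Local Notation wt := (word_t t).

(* [simulates n q v]: q = sum_i c_i (diag v_i) and v = sum_i c_i v_i for some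
   c_i = s_al p_Y t_be with |al| <= n; so v should be a linear function of q. *)
Inductive simulates (n : nat) : Q -> alg -> Prop :=
| SimGen al Y be v : core_word X al -> core_word X be -> (size al <= n)%N ->
    simulates n (rho (ws al * p Y * wt be) (diag_fun v)) (ws al * p Y * wt be * v)
| SimZero : simulates n 0 0
| SimAdd q v q' v' :
    simulates n q v -> simulates n q' v' -> simulates n (q + q') (v + v').

Lemma simulates_scale n r q v : simulates n q v -> simulates n (r *: q) (r *: v).
Proof.
elim=> [al Y be v' cal cbe sz||q1 v1 q2 v2 _ IH _ IH'].
- by rewrite -lendZ -diagZ -alg_scaleMr; apply: SimGen.
- by rewrite !scaler0; apply: SimZero.
- by rewrite !scalerDr; apply: SimAdd.
Qed.

Lemma simulates_mono n m q v : (n <= m)%N -> simulates n q v -> simulates m q v.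
Proof.
move=> nm; elim=> [al Y be v' cal cbe sz||q1 v1 q2 v2 _ IH _ IH'].
- by apply: SimGen => //; apply: leq_trans nm.
- exact: SimZero.
- exact: SimAdd.
Qed.

Lemma simulates_diag v : simulates 0 (diag_fun v) v.
Proof.
have := @SimGen 0 [::] (ba1 X) [::] v I I isT.
by rewrite word_s_nil word_t_nil (sf_p1 H) !mul1r rmorph1.
Qed.

Lemma core_word_cat al be : core_word X al -> core_word X be -> core_word X (al ++ be).
Proof. by elim: al => //= a al IH [ca cal] cbe; split=> //; apply: IH. Qed.

(** It suffices that left multiplication by c sends each s_al p_Y t_be to zero or to another such
    product, with control of the length of al. *)
Lemma simulates_act (c : alg) n m q v :
    (forall al Y be, core_word X al -> core_word X be -> (size al <= n)%N ->
      c * (ws al * p Y * wt be) = 0 \/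
      exists al' Y' be', [/\ c * (ws al * p Y * wt be) = ws al' * p Y' * wt be',
        core_word X al', core_word X be' & (size al' <= m)%N]) ->
  simulates n q v -> simulates m (rho c q) (c * v).
Proof.
move=> hc; elim=> [al Y be v' cal cbe sz||q1 v1 q2 v2 _ IH _ IH'].
- rewrite -lendME -rmorphM [X in simulates _ _ X]mulrA.
  have [->|[al' [Y' [be' [-> ? ? ?]]]]] := hc al Y be cal cbe sz.
    by rewrite rmorph0 mul0r; apply: SimZero.
  exact: SimGen.
- by rewrite lend0 mulr0; apply: SimZero.
- by rewrite lendD mulrDr; apply: SimAdd.
Qed.

Lemma simulates_p Y n q v : simulates n q v -> simulates n (rho (p Y) q) (p Y * v).
Proof.
apply: simulates_act => al Y' be cal cbe sz; right.
have [Z pZ] := p_word_s hX H Y cal.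
by exists al, (baI Z Y'), be; split=> //; rewrite !mulrA pZ (sf_pI H) mulrA.
Qed.

Lemma simulates_s a n q v : core a ->
  simulates n q v -> simulates n.+1 (rho (s a) q) (s a * v).
Proof.
move=> ca; apply: simulates_act => al Y' be cal cbe sz; right.
by exists (a :: al), Y', be; split=> //; rewrite word_s_cons !mulrA.
Qed.

(** In t_a s_al the first letter of al cancels against a, or the product vanishes; this drop of the
    bound drives the induction in [simulates_faithful]. For empty al, the letter a is appended to
    be. *)
Lemma simulates_t a n q v : core a ->
  simulates n q v -> simulates n.-1 (rho (t a) q) (t a * v).
Proof.
move=> ca; apply: simulates_act => -[|b al] Y be cal cbe sz.
  right; exists [::], (baP hX a Y), (be ++ [:: a]); split=> //.
    by rewrite word_s_nil !mul1r word_t_cat word_t1 !mulrA (t_p hX H).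
  by apply: core_word_cat.
case: cal => cb cal; rewrite word_s_cons !mulrA.
have [ab|ab] := pselect (a = b); last first.
  by left; rewrite (t_s_neq hX H) // !mul0r.
right; have [Z pZ] := p_word_s hX H (baP hX a (ba1 X)) cal.
exists al, (baI Z Y), be; split=> //; last by case: n sz.
by rewrite -ab (t_s hX H) // pZ (sf_pI H) !mulrA.
Qed.

Definition baPw w Y : BA X := foldl (fun Z a => baP hX a Z) Y w.

Lemma baPwE w Y x : sval (baPw w Y) x <-> sval Y (concat w x).
Proof.
elim: w Y => [|a w IH] Y; first by rewrite concat0.
by rewrite concat_cons; apply: IH.
Qed.

Lemma wt_p w Y : core_word X w -> wt w * p Y = p (baPw w Y) * wt w.
Proof.
elim: w Y => [|a w IH] Y; first by rewrite word_t_nil mulr1 mul1r.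
by move=> [ca cw]; rewrite word_t_cons -mulrA (t_p hX H) // mulrA IH // mulrA.
Qed.

Lemma wt_domain w : core_word X w -> p (baPw w (ba1 X)) * wt w = wt w.
Proof. by move=> cw; rewrite -wt_p // (sf_p1 H) mulr1. Qed.

Local Notation cword := (seq {classic A}).

(* A linear left inverse, at the point y, of the map sending a finite family (v_be)
   to the value at y of the sum of the t_be (diag v_be); the words be are told
   apart because be y determines be once its length is known. *)
Definition decode (L : seq cword) y (m : M) : alg :=
  \sum_(be <- undup L) wt be * m ((size be)%:Z, concat be y).

Lemma decodeD L y m m' : decode L y (m + m') = decode L y m + decode L y m'.
Proof. by rewrite -big_split /=; apply: eq_bigr => be _; rewrite -mulrDr. Qed.

Lemma decode0 L y : decode L y 0 = 0.
Proof. by rewrite /decode big1 // => be _; rewrite mulr0. Qed.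

Lemma decode_wt (L : seq cword) (be : cword) y v : be \in L -> X (concat be y) ->
  decode L y (ext (rho (wt be) (diag_fun v)) y) = wt be * v.
Proof.
move=> Lbe Xbey.
have lbe : language X be by apply/(languageP hX); exists y.
have Xy : X y by apply: (subshift_concat hX) Xbey.
rewrite /rho basic_rep_word_t //.
rewrite /decode (bigD1_seq be) ?undup_uniq ?mem_undup //= [X in _ + X]big1.
  by rewrite addr0 /degree_shift_fun diagE // asboolT //= subrr.
move=> be' /eqP nbe; rewrite /degree_shift_fun diagE // asboolF ?mulr0 // => -[sz e].
apply: nbe; apply: (concat_inj (x := y)) e.
by apply/eqP; rewrite -eqz_nat -subr_eq0 sz.
Qed.

Definition decoded_on (L : seq cword) q v Y : Prop :=
  forall L' y, {subset L <= L'} -> sval Y y -> p Y * v = p Y * decode L' y (ext q y).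

(** Every Y0 is a finite union of sets on which v is decoded, expressed as an induction principle
    for properties K closed under unions. A summand p_Y t_be splits a set into the part where it
    acts and the rest, where it is zero. *)
Lemma simulates0_decoded q v : simulates 0 q v -> exists L : seq cword,
  forall K : BA X -> Prop, (forall Y Z, K Y -> K Z -> K (baU Y Z)) ->
  forall Y0, (forall Y, (forall x, sval Y x -> sval Y0 x) -> decoded_on L q v Y -> K Y) ->
  K Y0.
Proof.
elim=> [[|//] Yg be vg _ cbe _||q1 v1 q2 v2 _ [L1 IH1] _ [L2 IH2]].
- exists [:: be : cword] => K KU Y0 KY.
  pose D := baI Yg (baPw be (ba1 X)).
  have -> : Y0 = baU (baI Y0 D) (baI Y0 (baD D)).
    apply: BA_ext => x; split=> [Yx|[[]|[]]//].
    have Xx := BA_sub Yx.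
    by have [Dx|nDx] := pselect (sval D x); [left | right].
  have cE : ws [::] * p Yg * wt be = p D * wt be.
    by rewrite word_s_nil mul1r /D (sf_pI H) -mulrA wt_domain.
  apply: KU; apply: KY; try by move=> x [].
    move=> L' y sL [Yy [Ygy /baPwE Ey]].
    rewrite cE rmorphM lendME /rho basic_rep_p mpE asboolT; last by split=> //; apply/baPwE.
    rewrite decode_wt ?sL ?mem_head // -!mulrA (mulrA _ (p D)) (p_sub H) //.
    by move=> x [].
  move=> L' y sL [Yy [Xy nDy]].
  rewrite cE rmorphM lendME /rho basic_rep_p mpE asboolF // decode0 mulr0.
  rewrite !mulrA -(sf_pI H) (p_empty H) ?mul0r //.
  by move=> x [[_ [_]]].
- exists [::] => K KU Y0 KY; apply: KY => // L' y _ _.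
  by rewrite ext0 decode0.
- exists (L1 ++ L2) => K KU Y0 KY.
  apply: (IH1 K KU) => Y1 Y10 dY1; apply: (IH2 K KU) => Y2 Y21 dY2.
  apply: KY => [x /Y21/Y10//|L' y sL Y2y].
  rewrite extD decodeD !mulrDr -dY2 //; last first.
    by move=> be Lbe; apply: sL; rewrite mem_cat Lbe orbT.
  have pY2 : p Y2 = p Y2 * p Y1 by rewrite (p_sub H).
  congr (_ + _); rewrite pY2 -!mulrA (dY1 L' y) ?mulrA //; last exact: Y21.
  by move=> be Lbe; apply: sL; rewrite mem_cat Lbe.
Qed.

(** Each piece annihilates v: at one of its points the value 0 decodes to 0, and an empty piece has
    projection 0. *)
Lemma simulates0_faithful v : simulates 0 0 v -> v = 0.
Proof.
move=> /simulates0_decoded[L hL].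
suff : p (ba1 X) * v = 0 by rewrite (sf_p1 H) mul1r.
apply: (hL (fun Y => p Y * v = 0)) => [Y Z Yv Zv|Y _ dY].
  by rewrite (sf_pU H) (sf_pI H) mulrBl mulrDl -mulrA Zv Yv mulr0 addr0 subr0.
have [[y Yy]|nY] := pselect (exists y, sval Y y).
  by rewrite (dY L y) // ext0 decode0 mulr0.
by rewrite (p_empty H) ?mul0r // => y Yy; apply: nY; exists y.
Qed.

(** S collects the first letters of the non-empty al. Such a summand starts with some s_a and is
    killed by 1 - p_Y as soon as Y contains the cylinder of a. *)
Lemma simulates_heads n q v : simulates n q v -> exists S,
  core_word X S /\ forall Y, (forall x, sval (baZs hX S) x -> sval Y x) ->
  simulates 0 (rho (1 - p Y) q) ((1 - p Y) * v).
Proof.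
elim=> [[|a al] Yg be vg cal cbe _||q1 v1 q2 v2 _ [S1 [cS1 IH1]] _ [S2 [cS2 IH2]]].
- exists [::]; split=> // Y _.
  rewrite -(p_compl H) word_s_nil mul1r.
  apply: simulates_p; have := @SimGen 0 [::] Yg be vg I cbe isT.
  by rewrite word_s_nil mul1r.
- case: cal => ca cal; exists [:: a]; split=> // Y ZY.
  have e : (1 - p Y) * (ws (a :: al) * p Yg * wt be) = 0.
    rewrite word_s_cons -(sf_sts H) (s_t hX H) // !mulrA mulrBl mul1r (p_comm H).
    by rewrite (p_sub H) ?subrr ?mul0r // => x Zx; apply: ZY; left.
  rewrite -lendME -rmorphM [X in simulates _ _ X]mulrA e rmorph0 mul0r.
  exact: SimZero.
- by exists [::]; split=> // Y _; rewrite lend0 mulr0; apply: SimZero.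
- exists (S1 ++ S2); split=> [|Y SY]; first exact: core_word_cat.
  have Zcat x : sval (baZs hX S1) x \/ sval (baZs hX S2) x -> sval (baZs hX (S1 ++ S2)) x.
    elim: S1 {cS1 IH1 SY} => [|a S1 IH] [Sx|Sx] //; last by right; apply: IH; right.
    by case: Sx => Sx; [left | right; apply: IH; left].
  rewrite lendD mulrDr; apply: SimAdd; [apply: IH1 | apply: IH2] => x Sx.
    by apply/SY/Zcat; left.
  by apply/SY/Zcat; right.
Qed.

Lemma heads_kill S v : core_word X S ->
  (forall a, core a -> t a * v = 0) -> p (baZs hX S) * v = 0.
Proof.
move=> + tv; elim: S => [_|a S IH [ca cS]]; first by rewrite /= (sf_p0 H) mul0r.
rewrite /= (sf_pU H) (sf_pI H) mulrBl mulrDl -mulrA IH // mulr0 addr0 subr0.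
by rewrite -(s_t hX H) // -mulrA tv // mulr0.
Qed.

(* The letter-by-letter induction: an element v with t_a v = 0 for all letters a
   and (1 - p_Y) v = 0 for a finite union Y of cylinders is zero. *)
Lemma simulates_faithful n v : simulates n 0 v -> v = 0.
Proof.
elim: n v => [|n IH] v; first exact: simulates0_faithful.
move=> Tv; have [S [cS hS]] := simulates_heads Tv.
have tv a : core a -> t a * v = 0.
  by move=> ca; apply: IH; have := simulates_t ca Tv; rewrite lend0.
have := hS (baZs hX S) (fun _ => id).
rewrite lend0 mulrBl mul1r heads_kill // subr0.
exact: simulates0_faithful.
Qed.

End Faithful.

(** * Local form of the operators *)

(** w is the companion matrix of 1 - g made monic, so g(w) = 1 by Cayley-Hamilton. As g has no
    constant term, w divides g(w) = 1 and is invertible. *)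
Lemma companion_root (R : fieldType) (g : {poly R}) : g != 0 -> g`_0 = 0 ->
  exists (d : nat) (w : 'M[R]_d.+1), w \is a GRing.unit /\ horner_mx w g = 1.
Proof.
move=> g0 g00; pose q := 1 - g.
have szg : (1 < size g)%N.
  rewrite ltnNge; apply/negP => /size1_polyC gC.
  by move: g0; rewrite gC g00 eqxx.
have szq : size q = size g by rewrite /q addrC size_polyDl size_polyN // size_poly1.
have q0 : q != 0 by rewrite -size_poly_gt0 szq ltnW.
have lq0 : (lead_coef q)^-1 != 0 by rewrite invr_eq0 lead_coef_eq0.
have qmon : (lead_coef q)^-1 *: q \is monic.
  by rewrite monicE lead_coefZ mulVf // lead_coef_eq0.
have [d e] : exists d, (size ((lead_coef q)^-1 *: q)%R).-1 = d.+1.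
  by rewrite size_scale // szq; case: (size g) szg => [|[|d]] // _; exists d.
have := companionmxK qmon; move: (companionmx _); rewrite e => w wq.
have gw : horner_mx w g = 1.
  have := Cayley_Hamilton w; rewrite wq linearZ /= => /eqP.
  by rewrite scaler_eq0 (negPf lq0) /= rmorphB rmorph1 subr_eq0 => /eqP.
exists d, w; split=> //.
have /factor_theorem[g1 gE] : root g 0 by rewrite rootE horner_coef0 g00.
have := gw; rewrite gE subr0 rmorphM /= horner_mx_X => w1.
by have [_] := mulmx1_unit w1.
Qed.

Section LocalForm.
Variables (A : Type) (X : set (nat -> A)) (hX : subshift X) (R : comPzRingType).
Implicit Types (a b : A) (al be w : seq A) (x y : nat -> A) (Y Z : BA X).
Local Notation core a := (language X [:: a]).
Local Notation XT := {x : nat -> A | X x}.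
Local Notation alg := (subshift_alg R X).
Implicit Types (c : alg).

(** One c serves all basic models at once, so that the action of Z may be chosen after c. *)
Definition moves y x (k : int) : Prop := exists c,
  forall (M : lmodType R) (W : int -> lend M) (hW : int_action W) (f : XT -> M),
  ext (basic_rep hX hW c f) y = W k (ext f x).

Lemma moves_refl x : moves x x 0.
Proof. by exists 1 => M W hW f; rewrite rmorph1 (int_action0 hW). Qed.

Lemma moves_trans y x z i j : moves z y i -> moves y x j -> moves z x (i + j).
Proof.
move=> [c hc] [c' hc']; exists (c * c') => M W hW f.
by rewrite rmorphM lendME hc hc' (int_actionD hW).
Qed.

Lemma moves_shift x : X x -> moves x (shift x) 1.
Proof.
by move=> Xx; exists (sa_s R X (x 0%N)) => M W hW f; rewrite basic_rep_sE // asboolT.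
Qed.

Lemma moves_cons a x : X (concat [:: a] x) -> moves x (concat [:: a] x) (-1).
Proof.
move=> Xx; exists (sa_t R X a) => M W hW f; rewrite basic_rep_tE //.
exact: (subshift_concat hX (w := [:: a])).
Qed.

Definition linked y x k : Prop := [/\ X x, moves y x k & moves x y (- k)].

Lemma linked_trans y x z i j : linked z y i -> linked y x j -> linked z x (i + j).
Proof.
move=> [_ zy yz] [Xx yx xy]; split=> //; first exact: moves_trans zy yx.
by rewrite opprD addrC; apply: moves_trans xy yz.
Qed.

Local Notation term := {classic (R * int * (nat -> A))}.
Definition coef (e : term) : R := e.1.1.
Definition deg (e : term) : int := e.1.2.
Definition pt (e : term) : nat -> A := e.2.

(** The list l is fixed before M and W, so the action of Z can later be adapted to the degrees found
    in l; the links allow a return from each point to y. *)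
Definition local_form c y (l : seq term) : Prop :=
  (forall e, e \in l -> linked y (pt e) (deg e)) /\
  forall (M : lmodType R) (W : int -> lend M) (hW : int_action W) (f : XT -> M),
  ext (basic_rep hX hW c f) y = \sum_(e <- l) coef e *: W (deg e) (ext f (pt e)).

Lemma local_form1 c y x r k : linked y x k ->
  (forall (M : lmodType R) (W : int -> lend M) (hW : int_action W) (f : XT -> M),
    ext (basic_rep hX hW c f) y = r *: W k (ext f x)) ->
  local_form c y [:: (r, k, x) : term].
Proof.
move=> yx cE; split=> [e|M W hW f]; last by rewrite big_seq1 cE.
by rewrite inE => /eqP ->.
Qed.

Lemma local_form0 c y :
  (forall (M : lmodType R) (W : int -> lend M) (hW : int_action W) (f : XT -> M),
    ext (basic_rep hX hW c f) y = 0) ->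
  local_form c y [::].
Proof. by move=> cE; split=> // M W hW f; rewrite big_nil cE. Qed.

Lemma local_formM c c' y l (l' : term -> seq term) : local_form c y l ->
  (forall e, e \in l -> local_form c' (pt e) (l' e)) ->
  local_form (c * c') y
    (flatten [seq [seq ((coef e * coef e', deg e + deg e', pt e') : term)
      | e' <- l' e] | e <- l]).
Proof.
move=> [lk lE] hl'; split=> [_ /flattenP[_ /mapP[e le ->] /mapP[e' le' ->]]|M W hW f].
  apply: linked_trans (lk _ le) _.
  by have [lk' _] := hl' _ le; exact: lk' le'.
rewrite rmorphM lendME lE big_flatten /= big_map big_seq [RHS]big_seq.
apply: eq_bigr => e le; have [_ ->] := hl' _ le.
rewrite big_map; elim/big_rec2: _ => [|e' m m' _ <-]; first by rewrite lend0 scaler0.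
by rewrite lendD scalerDr lendZ scalerA (int_actionD hW).
Qed.

(** Induction over an expression for c; a product is expanded at every point reached by its first
    factor. *)
Lemma local_form_exists c y : X y -> exists l, local_form c y l.
Proof.
elim/cls_ind: c => u; elim: u y => [r|Y|a|a|u IHu v IHv|u IHu|u IHu v IHv] y Xy.
- exists [:: (r, 0, y) : term]; apply: local_form1.
    by split=> //; rewrite ?oppr0; apply: moves_refl.
  by move=> M W hW f; rewrite basic_rep_iota extZ (int_action0 hW).
- have [Yy|nYy] := pselect (sval Y y).
    exists [:: (1, 0, y) : term]; apply: local_form1.
      by split=> //; rewrite ?oppr0; apply: moves_refl.
    move=> M W hW f; rewrite (basic_rep_p hX hW) mpE asboolT // (int_action0 hW).
    by rewrite scale1r.
  exists [::]; apply: local_form0 => M W hW f.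
  by rewrite (basic_rep_p hX hW) mpE asboolF.
- have [ya|ya] := pselect (y 0%N = a).
    exists [:: (1, 1, shift y) : term]; apply: local_form1.
      split; [exact: subshift_shift | exact: moves_shift |].
      by rewrite -[X in moves _ X](concat1_shift y); apply: moves_cons; rewrite concat1_shift.
    by move=> M W hW f; rewrite (basic_rep_sE hX hW) // asboolT // scale1r.
  exists [::]; apply: local_form0 => M W hW f.
  by rewrite (basic_rep_sE hX hW) // asboolF.
- have [Xay|nX] := pselect (X (concat [:: a] y)).
    exists [:: (1, -1, concat [:: a] y) : term]; apply: local_form1.
      split=> //; first exact: moves_cons.
      by rewrite opprK -[X in moves _ X](shift_concat1 a y); apply: moves_shift.
    by move=> M W hW f; rewrite (basic_rep_tE hX hW) // scale1r.
  exists [::]; apply: local_form0 => M W hW f.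
  by rewrite (basic_rep_tE hX hW) // ext_out ?lend0.
- have [l [lk lE]] := IHu y Xy; have [l' [lk' lE']] := IHv y Xy.
  exists (l ++ l'); split=> [e|M W hW f].
    by rewrite mem_cat => /orP[/lk|/lk'].
  by rewrite cls_add rmorphD lendDE extD lE lE' big_cat.
- have [l [lk lE]] := IHu y Xy.
  exists [seq ((- coef e, deg e, pt e) : term) | e <- l]; split=> [e|M W hW f].
    by move=> /mapP[e' /lk ? ->].
  rewrite cls_opp rmorphN lendNE -scaleN1r extZ lE big_map scaleN1r -sumrN.
  by apply: eq_bigr => e _; rewrite -scaleNr.
- have [l fl] := IHu y Xy.
  have hl' e : exists l', e \in l -> local_form (cls v) (pt e) l'.
    have [le|] := boolP (e \in l); last by exists [::].
    have [lk _] := fl; have [Xe _ _] := lk _ le.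
    by have [l' ?] := IHv _ Xe; exists l'.
  have [l' fl'] := choice hl'; eexists.
  by rewrite cls_mul; apply: (local_formM fl fl').
Qed.

(** For each other point of L, intersect with a cylinder around x that is long enough to include a
    place where the two differ. *)
Lemma separate x (L : seq {classic (nat -> A)}) : X x -> exists Y, sval Y x /\
  forall x', x' \in L -> sval Y x' -> x' = x.
Proof.
move=> Xx; elim: L => [|x1 L [Y [Yx YL]]]; first by exists (ba1 X).
have [->|nx] := pselect (x1 = x).
  exists Y; split=> // x'; rewrite (@in_cons {classic (nat -> A)}) => /orP[/eqP //|]; exact: YL.
have [n nxn] : exists n, x1 n <> x n.
  by apply: contrapT => nn; apply: nx; apply/funext => n; apply: contrapT => ?; apply: nn; exists n.
pose w := mkseq x n.+1.
pose D : BA X := exist _ _ (@boolean_algebra_C _ X [::] w).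
exists (baI Y D); split.
  split=> //; exists (fun k => x (n.+1 + k)%N); rewrite concat_mkseq ?concat0 //.
  split=> //; apply: (subshift_concat hX (w := w)); by rewrite concat_mkseq.
move=> x'; rewrite (@in_cons {classic (nat -> A)}) => /orP[/eqP -> [_ [z x1E _]]|Lx' [Yx' _]]; last exact: YL.
case: nxn; rewrite x1E /concat /w size_mkseq ltnSn nth_mkseq //.
Qed.

End LocalForm.

(** * The radical when all letters occur in the language *)

Section AllLettersCore.
Variables (A : Type) (X : set (nat -> A)) (hX : subshift X) (R : fieldType).
Implicit Types (a b : A) (al be w : seq A) (x y : nat -> A) (Y Z : BA X).
Local Notation core a := (language X [:: a]).
Local Notation XT := {x : nat -> A | X x}.
Local Notation alg := (subshift_alg R X).
Local Notation M0 := (int * (nat -> A) -> alg).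
Local Notation Q := (XT -> M0).
Implicit Types (c : alg).

Definition sim (q : Q) (v : alg) : Prop := exists n, simulates hX n q v.

Lemma sim_scale r q v : sim q v -> sim (r *: q) (r *: v).
Proof. by move=> [n nqv]; exists n; apply: simulates_scale. Qed.

Lemma sim_add q v q' v' : sim q v -> sim q' v' -> sim (q + q') (v + v').
Proof.
move=> [n nqv] [n' nqv']; exists (maxn n n'); apply: SimAdd.
  by apply: simulates_mono nqv; apply: leq_maxl.
by apply: simulates_mono nqv'; apply: leq_maxr.
Qed.

Lemma sim_diag v : sim (diag_fun v) v.
Proof. by exists 0%N; apply: simulates_diag. Qed.

Lemma sim_faithful v : sim 0 v -> v = 0.
Proof. by move=> [n]; apply: simulates_faithful. Qed.

Lemma sim_core_s a q v : core a -> sim q v ->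
  sim (ms X (degree_shift X R) a q) (sa_s R X a * v).
Proof.
move=> ca [n nqv]; exists n.+1; have := simulates_s ca nqv.
by rewrite /rho basic_rep_s.
Qed.

Lemma sim_core_t a q v : core a -> sim q v ->
  sim (mt X (degree_shift X R) a q) (sa_t R X a * v).
Proof.
move=> ca [n nqv]; exists n.-1; have := simulates_t ca nqv.
by rewrite /rho basic_rep_t.
Qed.

Lemma sim_p Y q v : sim q v -> sim (mp M0 Y q) (sa_p R Y * v).
Proof.
move=> [n nqv]; exists n; have := simulates_p Y nqv.
by rewrite /rho basic_rep_p.
Qed.

(** Used for the basic model and again for a model altered at the letters outside of the
    language. *)
Lemma sim_alg (F : {rmorphism alg -> lend Q}) :
    (forall r q, F (sa_iota X r) q = r *: q) ->
    (forall Y, F (sa_p R Y) = mp M0 Y) ->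
    (forall a q v, sim q v -> sim (F (sa_s R X a) q) (sa_s R X a * v)) ->
    (forall a q v, sim q v -> sim (F (sa_t R X a) q) (sa_t R X a * v)) ->
  forall c q v, sim q v -> sim (F c q) (c * v).
Proof.
move=> Fr Fp Fs Ft; elim/cls_ind => u.
elim: u => [r|Y|a|a|u IHu u' IHu'|u IHu|u IHu u' IHu'] q v qv.
- by rewrite (Fr r q); apply: sim_scale.
- by rewrite (Fp Y); apply: sim_p.
- exact: Fs.
- exact: Ft.
- rewrite cls_add rmorphD lendDE mulrDl.
  by apply: sim_add; [apply: IHu | apply: IHu'].
- rewrite cls_opp rmorphN lendNE mulNr -scaleN1r.
  rewrite -[- (_ * v)](scaleN1r (cls u * v)).
  by apply: sim_scale; apply: IHu.
- by rewrite cls_mul rmorphM lendME -mulrA; apply: IHu; apply: IHu'.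
Qed.

Hypothesis all_core : forall a, core a.

Lemma sim_rho c : sim (rho hX R c (diag_fun 1)) c.
Proof.
rewrite -[X in sim _ X]mulr1; apply: sim_alg (sim_diag 1).
- exact: basic_rep_iota.
- exact: basic_rep_p.
- by move=> a q v; rewrite /rho basic_rep_s //; apply: sim_core_s.
- by move=> a q v; rewrite /rho basic_rep_t //; apply: sim_core_t.
Qed.

(** If v is the inverse of 1 - h, the constant function f = m equals (1 - h) v f, whose value at y
    is zero. *)
Lemma radical_no_fixed_point (h : alg) y (M : lmodType R) (W : int -> lend M)
    (hW : int_action W) (m : M) : jacobson_radical h -> X y -> m <> 0 ->
  (forall f, ext (basic_rep hX hW h f) y = ext f y) -> False.
Proof.
move=> Jh Xy m0 hfix; apply: m0.
have [v [_ hv]] := jacobson_invertible Jh.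
pose f : XT -> M := fun=> m.
have : ext (basic_rep hX hW ((1 - h) * v) f) y = 0.
  rewrite rmorphM rmorphB rmorph1 lendME lendDE lendNE lend1E extD.
  by rewrite -scaleN1r extZ hfix scaleN1r subrr.
by rewrite hv rmorph1 lend1E; rewrite /ext; case: pselect.
Qed.

Lemma moves_loop x k n : moves hX R x x k -> moves hX R x x (k * n%:Z).
Proof.
move=> xk; elim: n => [|n IH]; first by rewrite mulr0; apply: moves_refl.
by rewrite -addn1 PoszD mulrDr mulr1; apply: moves_trans IH xk.
Qed.

Lemma radical_all_core (b : alg) : jacobson_radical b -> b = 0.
Proof.
move=> Jb; apply: contrapT => b0.
have [y [Xy [[k x] ykx]]] : exists y, X y /\ exists kx,
    ext (rho hX R b (diag_fun 1)) y kx <> 0.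
  apply: contrapT => nex; apply: b0; apply: sim_faithful.
  suff <- : rho hX R b (diag_fun 1) = 0 by apply: sim_rho.
  apply: extP => y Xy; rewrite ext0; apply/funext => kx; apply: contrapT => ykx.
  by apply: nex; exists y; split=> //; exists kx.
have [l [lk lE]] := local_form_exists hX b Xy.
(* The entry (k, x) at y collects the terms of the local form at the point x in degree - k; it is
   [co] times 1. *)
pose lx := [seq e <- l | `[< pt e = x >]].
pose co := \sum_(e <- lx | deg e == - k) coef e.
have co0 : co != 0.
  apply/eqP => co0; apply: ykx; rewrite lE.
  have -> : \sum_(e <- l) coef e *: degree_shift X R (deg e)
      (ext (diag_fun 1) (pt e)) = \sum_(e <- l) (fun kx =>
      if `[< kx.1 + deg e = 0 /\ kx.2 = pt e >] then coef e *: (1 : alg) else 0).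
    rewrite big_seq [RHS]big_seq; apply: eq_bigr => e /lk[Xe _ _].
    apply/funext => kx.
    change (coef e *: (ext (diag_fun 1) (pt e) (kx.1 + deg e, kx.2)) =
      if `[< kx.1 + deg e = 0 /\ kx.2 = pt e >] then coef e *: (1 : alg) else 0).
    by rewrite diagE //; case: ifP => // _; rewrite scaler0.
  rewrite fct_sumE -[RHS](scale0r (1 : alg)) -co0 scaler_suml big_filter_cond.
  rewrite [RHS]big_mkcond /=; apply: eq_bigr => e _ /=.
  rewrite (_ : `[< _ /\ _ >] = `[< pt e = x >] && (deg e == - k)) //.
  rewrite asbool_and andbC; congr (_ && _); first by apply/asboolP/asboolP.
  by rewrite -addr_eq0 addrC; apply/asboolP/eqP.
have [e0 lxe0 dege0] : exists2 e0, e0 \in lx & deg e0 = - k.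
  apply: contrapT => nex; move/negP: co0; apply; rewrite /co big_seq_cond big1 //.
  by move=> e /andP[lxe /eqP ke]; case: nex; exists e.
have lxE e : e \in lx -> e \in l /\ pt e = x.
  by rewrite mem_filter => /andP[/asboolP].
have [Xx yx0 xy0] : linked hX R y x (- k).
  by have [le0 <-] := lxE _ lxe0; rewrite -dege0; apply: lk.
(* Multiplication by p_Y removes all terms of l except those at x. *)
have [Y [Yx YL]] := separate hX [seq (pt e : {classic (nat -> A)}) | e <- l] Xx.
pose b1 := b * sa_p R Y.
have b1E (M : lmodType R) (W : int -> lend M) (hW : int_action W) (f : XT -> M) :
    ext (basic_rep hX hW b1 f) y = \sum_(e <- lx) coef e *: W (deg e) (ext f x).
  rewrite rmorphM lendME lE big_filter [RHS]big_mkcond big_seq [RHS]big_seq /=.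
  apply: eq_bigr => e le; rewrite (basic_rep_p hX hW) mpE.
  case: (asboolP (pt e = x)) => [->|nx]; first by rewrite asboolT.
  by rewrite asboolF ?lend0 ?scaler0 // => Ye; apply/nx/YL => //; apply: map_f.
(* If only the degree - k occurs at x, then b1 acts at y as [co] times the transport from x, and the
   trivial action of Z suffices. *)
have [same|/existsNP[e1 /not_implyP[lxe1 k1]]] :=
    pselect (forall e, e \in lx -> deg e = - k).
  have [c hc] := xy0; pose W := fun _ : int => (1 : lend R^o).
  have hW : int_action W by split=> // i j; rewrite /W mulr1.
  apply: (@radical_no_fixed_point (sa_iota X co^-1 * (b1 * c)) y _ W hW 1) => //.
  - by apply: jacobsonMl; apply: jacobsonMr; apply: jacobsonMr.
  - by apply/eqP; apply: oner_neq0.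
  move=> f; rewrite rmorphM lendME basic_rep_iota extZ rmorphM lendME b1E.
  rewrite -scaler_suml hc scalerA (_ : \sum_(e <- lx) coef e = co).
    by rewrite mulVf // scale1r.
  rewrite /co big_seq [RHS]big_seq_cond; apply: eq_bigl => e.
  by case lxe : (e \in lx) => //=; rewrite same ?eqxx.
(* Two different degrees between y and x give a loop at x, traversed in the direction of positive
   degree. *)
have [d [d0 xd]] : exists d : nat, (0 < d)%N /\ moves hX R x x d%:Z.
  have [Xx' yx1 xy1] : linked hX R y x (deg e1).
    by have [le1 <-] := lxE _ lxe1; apply: lk.
  have [kk|kk|kk] := ltrgtP (deg e1) (- k); last by case: k1.
    exists `|(- k - deg e1)%R|%N; rewrite absz_gt0 subr_eq0 gt_eqF // gez0_abs ?subr_ge0 ?ltW //.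
    by split=> //; rewrite addrC; apply: moves_trans xy1 yx0.
  exists `|(deg e1 + k)%R|%N; rewrite -{1 2}[k]opprK absz_gt0 subr_eq0 gt_eqF //.
  rewrite gez0_abs ?subr_ge0 ?ltW //; split=> //.
  by rewrite addrC; apply: moves_trans xy0 yx1.
(* N rounds of the loop before the return to y make all exponents deg e + d N + k positive, so that
   g is a polynomial without constant term. *)
pose N := (\sum_(e <- lx) `|deg e| + `|k| + 1)%N.
have [c hc] := moves_trans (moves_loop N xd) xy0.
rewrite opprK in hc.
have posdeg e : e \in lx -> (0 < deg e + (d%:Z * N%:Z + k)).
  move=> lxe; have le : (`|deg e| <= \sum_(e <- lx) `|deg e|)%N.
    by rewrite (big_rem e) //= leq_addr.
  have : (N <= d * N)%N by rewrite leq_pmull.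
  rewrite /N; lia.
pose g : {poly R} := \sum_(e <- lx) coef e *: 'X^(`|(deg e + (d%:Z * N%:Z + k))%R|%N).
have [||d' [w [wu gw]]] := @companion_root R g.
- apply/eqP => g0; move/eqP: co0; apply.
  (* The coefficient at d N collects exactly the terms of degree - k, so it is [co]. *)
  have := congr1 (fun h : {poly R} => h`_(d * N)) g0.
  rewrite coef0 coef_sum => <-; rewrite /co big_mkcond big_seq [RHS]big_seq.
  apply: eq_bigr => e lxe; rewrite coefZ coefXn.
  have := posdeg _ lxe; case: eqVneq => [->|nk] pd.
    by rewrite (_ : _ == _ = true) ?mulr1 //; apply/eqP; lia.
  rewrite (_ : _ == _ = false) ?mulr0 //; apply/negP => /eqP e'; move/eqP: nk; apply; lia.
- rewrite coef_sum big_seq big1 // => e lxe; rewrite coefZ coefXn.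
  by have := posdeg _ lxe; rewrite eq_sym absz_eq0; case: eqVneq => [->|]; rewrite ?ltxx ?mulr0.
(* When 1 in Z acts as left multiplication by w, the element b1 c acts at y as g(w) = 1. *)
have Wlin i : linear (fun m : 'M[R]_d'.+1 => w ^ i * m).
  by move=> r m m'; rewrite mulrDr scalerAr.
pose W i := Lend (Wlin i).
have hW : int_action W.
  split=> [|i j]; apply: lendP => m /=; first by rewrite expr0z mul1r.
  by rewrite exprzDr ?mulrA.
apply: (@radical_no_fixed_point (b1 * c) y _ W hW 1) => //.
- by apply: jacobsonMr; apply: jacobsonMr.
- by apply/eqP; apply: oner_neq0.
move=> f; rewrite rmorphM lendME b1E -[RHS]mul1r -gw /g raddf_sum mulr_suml.
rewrite big_seq [RHS]big_seq; apply: eq_bigr => e lxe.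
rewrite hc -lendME -(int_actionD hW) /= linearZ /= rmorphXn /= horner_mx_X.
have := posdeg _ lxe; rewrite -scalerAl => pd; congr (_ *: (_ * _)).
by rewrite exprnP gez0_abs ?ltW.
Qed.

End AllLettersCore.

(** * Letters outside of the language *)

Section Involution.
Variables (A : Type) (X : set (nat -> A)) (R : comPzRingType).
Local Notation alg := (subshift_alg R X).
Local Notation H := (sa_family R X).

Lemma star_iota_additive : zmod_morphism (sa_iota X : R -> alg^c).
Proof. exact: sa_iota_is_additive. Qed.
Lemma star_iota_monoid : monoid_morphism (sa_iota X : R -> alg^c).
Proof.
split=> // r r'; rewrite mulrC.
exact: (rmorphM (@sa_iota R A X) r' r).
Qed.
Definition star_iota : {rmorphism R -> alg^c} :=
  HB.pack (sa_iota X : R -> alg^c)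
    (GRing.isZmodMorphism.Build R alg^c _ star_iota_additive)
    (GRing.isMonoidMorphism.Build R alg^c _ star_iota_monoid).

Lemma converse_prod (I : Type) (r : seq I) (F : I -> alg) :
  \prod_(i <- r) (F i : alg^c) = \prod_(i <- rev r) F i.
Proof.
elim: r => [|i r IH]; first by rewrite !big_nil.
by rewrite big_cons rev_cons big_rcons IH.
Qed.

(** In the opposite algebra s_a and t_a exchange their roles; the product in [sf_C] is unchanged
    when it is reversed and s and t are exchanged. *)
Lemma star_family : subshift_family star_iota (@sa_p R A X : BA X -> alg^c)
  (@sa_t R A X : A -> alg^c) (@sa_s R A X : A -> alg^c).
Proof.
split.
- by move=> r b; apply: esym (sf_central H r b).
- exact: sf_p1 H.
- by move=> Y Z; rewrite (sf_pI H); apply: (p_comm H).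
- exact: sf_pU H.
- exact: sf_p0 H.
- by move=> a; apply: etrans (sf_tst H a); apply: (@mulrA alg).
- by move=> a; apply: etrans (sf_sts H a); apply: (@mulrA alg).
- move=> al be hal hbe; rewrite /word_s /word_t !converse_prod !revK.
  by apply: etrans (sf_C H hal hbe); rewrite -!(@mulrA alg).
Qed.

(** The homomorphism to the opposite algebra exchanging s_a and t_a. Its square fixes all
    generators, hence is the identity, which gives injectivity. *)
Lemma star_exists : exists F : alg -> alg, [/\ F 0 = 0, forall x y, F (x * y) = F y * F x,
  forall Y, F (sa_p R Y) = sa_p R Y & forall x, F x = 0 -> x = 0].
Proof.
have [f [fi fp fs ft]] := subshift_alg_lift star_family.
exists f; split=> //; [exact: (rmorph0 f) | exact: (rmorphM f) |].
have ff_is_additive : zmod_morphism ((f : alg -> alg) \o (f : alg -> alg)).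
  by move=> x y /=; rewrite !(raddfB f).
have ff_is_monoid : monoid_morphism ((f : alg -> alg) \o (f : alg -> alg)).
  by split=> [|x y] /=; [rewrite !(rmorph1 f) | rewrite !(rmorphM f)].
pose ff : {rmorphism alg -> alg} := HB.pack ((f : alg -> alg) \o (f : alg -> alg))
  (GRing.isZmodMorphism.Build alg alg _ ff_is_additive)
  (GRing.isMonoidMorphism.Build alg alg _ ff_is_monoid).
have ffK : ff =1 (idfun : {rmorphism alg -> alg}).
  apply: subshift_alg_unique => [r|Y|a|a] /=; rewrite ?fi ?fp ?fs ?ft //.
by move=> x fx; apply: etrans (esym (ffK x)) _; rewrite /= fx; apply: (raddf0 f).
Qed.

End Involution.

(** * The radical when some letter lies outside of the language *)

Section ForeignLetter.
Variables (A : Type) (X : set (nat -> A)) (hX : subshift X) (R : fieldType).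
Implicit Types (a b : A) (al be w : seq A) (x y : nat -> A) (Y Z : BA X).
Local Notation core a := (language X [:: a]).
Local Notation XT := {x : nat -> A | X x}.
Local Notation alg := (subshift_alg R X).
Local Notation M := (int * (nat -> A) -> alg).
Local Notation Q := (XT -> M).
Local Notation H := (sa_family R X).
Local Notation p := (sa_p R).
Local Notation s := (sa_s R X).
Local Notation t := (sa_t R X).
Local Notation ws := (word_s s).
Local Notation wt := (word_t t).
Local Notation deg1 := (degree_shift_action X R).
Implicit Types (c v : alg) (q : Q).

Section Override.
Variables (pi : Q -> alg) (phi psi : Q -> R^o) (xx yy : A -> Q).
Hypotheses (pi_lin : linear pi) (phi_lin : linear phi) (psi_lin : linear psi).
Hypotheses (pi_diag : forall v, pi (diag_fun v) = v).
Hypotheses (phi_diag : forall v, phi (diag_fun v) = 0).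
Hypotheses (psi_diag : forall v, psi (diag_fun v) = 0).
Hypotheses (pi_x : forall a, pi (xx a) = 0) (pi_y : forall a, pi (yy a) = 0).
(** This form covers both phi(xx a) = psi(yy a) = 1 and the absence of a perturbation, xx a = yy a =
    0. *)
Hypotheses (phi_x : forall a, phi (xx a) *: yy a = yy a).
Hypotheses (psi_y : forall a, psi (yy a) *: yy a = yy a).
Hypotheses (phi_x' : forall a, phi (xx a) *: xx a = xx a).
Hypotheses (psi_y' : forall a, psi (yy a) *: xx a = xx a).

(* Since pi (diag v) = v, the relations between s a and t a in the algebra carry
   over; yy and xx span the ranges of the perturbations of rank one. *)
Definition over_s_fun a q : Q := diag_fun (s a * pi q) + phi q *: yy a.
Definition over_t_fun a q : Q := diag_fun (t a * pi q) + psi q *: xx a.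

Fact over_s_linear a : linear (over_s_fun a).
Proof.
move=> r q q'; rewrite /over_s_fun pi_lin phi_lin mulrDr alg_scaleMr diag_linear.
by rewrite scalerDl -scalerA scalerDr addrACA.
Qed.
Fact over_t_linear a : linear (over_t_fun a).
Proof.
move=> r q q'; rewrite /over_t_fun pi_lin psi_lin mulrDr alg_scaleMr diag_linear.
by rewrite scalerDl -scalerA scalerDr addrACA.
Qed.

Definition over_s a := Lend (over_s_linear a).
Definition over_t a := Lend (over_t_linear a).

Lemma linear_affine (U : lmodType R) (f : Q -> U) q q' r :
  linear f -> f (q + r *: q') = f q + r *: f q'.
Proof. by move=> flin; rewrite addrC flin addrC. Qed.

Lemma over_sts a : over_s a * over_t a * over_s a = over_s a.
Proof.
apply: lendP => q; rewrite !lendME /= /over_s_fun /over_t_fun.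
rewrite !(linear_affine _ _ _ pi_lin) !(linear_affine _ _ _ phi_lin).
rewrite !(linear_affine _ _ _ psi_lin) !pi_diag !phi_diag !psi_diag.
rewrite !pi_x !pi_y !scaler0 !addr0 !add0r !mulrA (sf_sts H).
by rewrite -!scalerA phi_x psi_y.
Qed.

Lemma over_tst a : over_t a * over_s a * over_t a = over_t a.
Proof.
apply: lendP => q; rewrite !lendME /= /over_s_fun /over_t_fun.
rewrite !(linear_affine _ _ _ pi_lin) !(linear_affine _ _ _ phi_lin).
rewrite !(linear_affine _ _ _ psi_lin) !pi_diag !phi_diag !psi_diag.
rewrite !pi_x !pi_y !scaler0 !addr0 !add0r !mulrA (sf_tst H).
by rewrite -!scalerA psi_y' phi_x'.
Qed.

Lemma over_rep : exists F : {rmorphism alg -> lend Q},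
  [/\ forall r q, F (sa_iota X r) q = r *: q,
      forall Y, F (p Y) = mp M Y,
      forall a, core a -> F (s a) = ms X (degree_shift X R) a /\
        F (t a) = mt X (degree_shift X R) a,
      forall a q, ~ core a -> F (s a) q = diag_fun (s a * pi q) + phi q *: yy a /\
        F (t a) q = diag_fun (t a * pi q) + psi q *: xx a &
      forall w q y, language X w -> X y -> ext (F (wt w) q) y =
        degree_shift X R (- (size w)%:Z) (ext q (concat w y))].
Proof.
exists (model_rep hX deg1 over_sts over_tst); split.
- by move=> r q; apply: model_rep_iota.
- by move=> Y; apply: model_rep_p.
- by move=> a ca; rewrite model_rep_s model_rep_t /rs /rt !asboolT.
- by move=> a q ca; rewrite model_rep_s model_rep_t /rs /rt !asboolF.
- by move=> w q y lw Xy; rewrite model_rep_word_t (rt_wordE hX deg1).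
Qed.

End Override.

(** * Functions of bounded degree and locality of the action *)

Definition supported n q : Prop := forall z k, (n < `|k.1|)%N -> q z k = 0.
Definition trunc n q : Q := fun z k => if (`|k.1| <= n)%N then q z k else 0.

Lemma trunc_linear n : linear (trunc n).
Proof.
move=> r q q'; apply/funext => z; apply/funext => k.
change (trunc n (r *: q + q') z k = r *: trunc n q z k + trunc n q' z k).
by rewrite /trunc; case: ifP => // _; rewrite scaler0 addr0.
Qed.

Lemma trunc_id n q : supported n q -> trunc n q = q.
Proof.
move=> nq; apply/funext => z; apply/funext => k; rewrite /trunc.
by case: leqP => // kn; rewrite nq.
Qed.

Lemma supported_mono n m q : (n <= m)%N -> supported n q -> supported m q.
Proof. by move=> nm nq z k mk; apply: nq; apply: leq_ltn_trans mk. Qed.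

Lemma supported_ext n q y k : supported n q -> (n < `|k.1|)%N -> ext q y k = 0.
Proof. by move=> nq nk; rewrite /ext; case: pselect => // h; apply: nq. Qed.

Lemma ext_supported n q :
  (forall y k, X y -> (n < `|k.1|)%N -> ext q y k = 0) -> supported n q.
Proof. by move=> nq z k nk; rewrite -ext_val nq //; apply: svalP. Qed.

Lemma supported_diag v : supported 0 (diag_fun v).
Proof.
apply: ext_supported => y [k x] Xy /= k0; rewrite diagE // asboolF // => -[k1 _].
by rewrite k1 in k0.
Qed.

Lemma supportedD n q q' : supported n q -> supported n q' -> supported n (q + q').
Proof.
move=> nq nq' z k nk; change (q z k + q' z k = 0).
by rewrite nq // nq' // addr0.
Qed.

Lemma supportedZ n r q : supported n q -> supported n (r *: q).
Proof.
by move=> nq z k nk; change (r *: q z k = 0); rewrite nq // scaler0.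
Qed.

Lemma supported_p n Y q : supported n q -> supported n (mp M Y q).
Proof.
move=> nq; apply: ext_supported => y k Xy nk; rewrite mpE.
by case: ifP => // _; apply: supported_ext nq nk.
Qed.

Lemma supported_s n a q : supported n q -> supported n.+1 (ms X (degree_shift X R) a q).
Proof.
move=> nq; apply: ext_supported => y [k x] Xy /= nk; rewrite ext_mk //.
case: ifP => // _; rewrite degree_shiftE (supported_ext _ nq) //=; lia.
Qed.

Lemma supported_t n a q : supported n q -> supported n.+1 (mt X (degree_shift X R) a q).
Proof.
move=> nq; apply: ext_supported => y [k x] Xy /= nk; rewrite ext_mk //.
rewrite degree_shiftE (supported_ext _ nq) //=; lia.
Qed.

(** Defined on expressions, not on elements of the algebra; it bounds by how much u can raise the
    degree. *)
Fixpoint letters (u : expr R X) : nat :=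
  match u with
  | Scal _ | Proj _ => 0
  | Gen _ | GenStar _ => 1
  | Add u v | Mul u v => letters u + letters v
  | Opp u => letters u
  end.

(** Each letter raises the degree by at most one, so while the total stays within N the evaluation
    of u only meets functions on which F and G agree. *)
Lemma locality N (F G : {rmorphism alg -> lend Q}) :
    (forall r q, F (sa_iota X r) q = r *: q) ->
    (forall r q, G (sa_iota X r) q = r *: q) ->
    (forall Y, F (p Y) = mp M Y) -> (forall Y, G (p Y) = mp M Y) ->
    (forall n a q, (n < N)%N -> supported n q ->
      G (s a) q = F (s a) q /\ supported n.+1 (F (s a) q)) ->
    (forall n a q, (n < N)%N -> supported n q ->
      G (t a) q = F (t a) q /\ supported n.+1 (F (t a) q)) ->
  forall u n q, (n + letters u <= N)%N -> supported n q ->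
    G (cls u) q = F (cls u) q /\ supported (n + letters u) (F (cls u) q).
Proof.
move=> Fr Gr Fp Gp GFs GFt.
elim=> [r|Y|a|a|u IHu v IHv|u IHu|u IHu v IHv] /= n q uN nq.
- by rewrite (Gr r) (Fr r) addn0; split=> //; apply: supportedZ.
- by rewrite (Gp Y) (Fp Y) addn0; split=> //; apply: supported_p.
- by rewrite addn1; apply: GFs => //; rewrite addn1 in uN.
- by rewrite addn1; apply: GFt => //; rewrite addn1 in uN.
- rewrite cls_add !rmorphD !lendDE.
  have [|-> Su] := IHu n q _ nq; first by lia.
  have [|-> Sv] := IHv n q _ nq; first by lia.
  split=> //; apply: supportedD; [apply: supported_mono Su | apply: supported_mono Sv]; lia.
- rewrite cls_opp !rmorphN !lendNE; have [-> Su] := IHu n q uN nq.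
  by split=> //; rewrite -scaleN1r; apply: supportedZ.
- rewrite cls_mul !rmorphM !lendME.
  have [|-> Sv] := IHv n q _ nq; first by lia.
  have [|-> Su] := IHu _ _ _ Sv; first by lia.
  by split=> //; apply: supported_mono Su; lia.
Qed.

(** [sim] is a linear relation, single-valued by [sim_faithful], and so extends to a linear map on
    all of Q. *)
Lemma sim_projection : exists pi : Q -> alg, linear pi /\ forall q v, sim hX q v -> pi q = v.
Proof.
have [||pi [pil piE]] := @linear_extension R Q alg [set qv | sim hX qv.1 qv.2].
- split; first by rewrite /= -[X in sim _ X](diag0 X R); apply: sim_diag.
  by move=> r qv qv' S S'; apply: sim_add => //; apply: sim_scale.
- by move=> v; apply: sim_faithful.
by exists pi; split=> // q v S; apply: (piE (q, v)).
Qed.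

Variables (a0 : A) (a0_out : ~ core a0).

Lemma language_mkseq y n : X y -> language X (mkseq y n).
Proof.
move=> Xy; apply/(languageP hX); exists (fun k => y (n + k)%N).
by rewrite concat_mkseq.
Qed.

Lemma radical_foreign_letter (b : alg) : jacobson_radical b -> b = 0.
Proof.
move=> Jb; apply: contrapT => b0.
have [pi [pi_lin piE]] := sim_projection.
have pi_diag v : pi (diag_fun v) = v by apply/piE/sim_diag.
have lin0 (U : lmodType R) (f : Q -> U) : linear f -> f 0 = 0.
  by move=> fl; have := fl (-1) 0 0; rewrite !scaleN1r !addNr.
have zlin : linear (fun _ : Q => 0 : R^o) by move=> r q q'; rewrite scaler0 addr0.
have z0 (f : Q -> R^o) (a : A) : f 0 *: (0 : Q) = 0 by rewrite scaler0.
(* F1 is the model with phi = psi = 0. It is faithful on the whole algebra because pi reads v off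
   from any q simulating v. *)
have [F1 [F1r F1p F1c F1o F1wt]] := over_rep pi_lin zlin zlin pi_diag
  (fun=> erefl) (fun=> erefl)
  (fun _ : A => lin0 _ _ pi_lin) (fun _ : A => lin0 _ _ pi_lin)
  (z0 (fun=> 0)) (z0 (fun=> 0)) (z0 (fun=> 0)) (z0 (fun=> 0)).
have F1sim c v : sim hX (F1 c (diag_fun v)) (c * v).
  apply: sim_alg (sim_diag hX v) => // a q u qu.
    have [ca|nca] := pselect (core a).
      by have [-> _] := F1c a ca; apply: sim_core_s.
    have [-> _] := F1o a q nca.
    by rewrite scale0r addr0 (piE _ _ qu); apply: sim_diag.
  have [ca|nca] := pselect (core a).
    by have [_ ->] := F1c a ca; apply: sim_core_t.
  have [_ ->] := F1o a q nca.
  by rewrite scale0r addr0 (piE _ _ qu); apply: sim_diag.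
have F1_neq0 c : c <> 0 -> exists y, X y /\ exists k, ext (F1 c (diag_fun 1)) y k <> 0.
  move=> c0; apply: contrapT => nex; apply: c0.
  apply: (@sim_faithful A X hX R); rewrite -[X in sim _ _ X](mulr1 c).
  suff <- : F1 c (diag_fun 1) = 0 by apply: F1sim.
  apply: extP => y Xy; rewrite ext0; apply/funext => k; apply: contrapT => yk.
  by apply: nex; exists y; split=> //; exists k.
(* A shift by m > 2 N carries degrees between - N and N to degrees above N. *)
pose ub := repr b; have bE : b = cls ub by rewrite cls_repr.
pose N := letters ub; pose m := (N + N).+1.
(* The aim is b p_C <> 0 for the cylinder C of a word be of length m. By faithfulness (star b) acts
   with non-zero value at some y; with be the beginning of y, p_C (star b) is non-zero, and the star
   turns it into b p_C. *)
have [star [star0 starM starp star_inj]] := star_exists X R.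
have [y [Xy [ky ykn]]] : exists y, X y /\ exists k, ext (F1 (star b) (diag_fun 1)) y k <> 0.
  by apply: F1_neq0 => /star_inj.
pose be := mkseq y m; have lbe : language X be := language_mkseq m Xy.
have lnil := language_nil hX Xy.
pose C : BA X := baC lnil lbe.
have CE z : X z -> X (concat be z) -> sval C (concat be z).
  by move=> Xz Xbz; exists z => //; rewrite concat0.
have ytail := concat_mkseq y m; rewrite -/be in ytail.
pose y' := fun k => y (m + k)%N; rewrite -/y' in ytail.
have Xy' : X y' by apply: (subshift_concat hX (w := be)); rewrite ytail.
have Cy : sval C y by rewrite -[X in sval C X]ytail; apply: CE => //; rewrite ytail.
have bC : b * p C <> 0.
  move=> bC0; apply: ykn; have := congr1 star bC0; rewrite starM starp star0 => pCb.
  have e : mp M C (F1 (star b) (diag_fun 1)) = 0 by rewrite -F1p -lendME -rmorphM pCb rmorph0.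
  by have := congr1 (fun q => ext q y ky) e; rewrite mpE asboolT // ext0.
pose q0 : Q := mp M C (diag_fun 1).
have q0E : F1 (p C) (diag_fun 1) = q0 by rewrite F1p.
have Sq0 : supported 0 q0 by apply/supported_p/supported_diag.
pose u := F1 b q0.
have [y1 [Xy1 [[k1 x1] uk1]]] : exists y, X y /\ exists k, ext u y k <> 0.
  by have := F1_neq0 _ bC; rewrite rmorphM lendME q0E.
pose ga := mkseq y1 m; have lga : language X ga := language_mkseq m Xy1.
have y1tail := concat_mkseq y1 m; rewrite -/ga in y1tail.
pose y1' := fun k => y1 (m + k)%N; rewrite -/y1' in y1tail.
have Xy1' : X y1' by apply: (subshift_concat hX (w := ga)); rewrite y1tail.
have szga : size ga = m by rewrite size_mkseq.
have szbe : size be = m by rewrite size_mkseq.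
have F1loc n a q : supported n q ->
    supported n.+1 (F1 (s a) q) /\ supported n.+1 (F1 (t a) q).
  move=> nq; have [ca|nca] := pselect (core a).
    have [-> ->] := F1c a ca; split; first exact: supported_s.
    exact: supported_t.
  have [-> ->] := F1o a q nca; rewrite !scale0r !addr0.
  by split; apply: supported_mono (supported_diag _).
have Su : supported N u.
  suff [] : F1 (cls ub) q0 = F1 (cls ub) q0 /\ supported (0 + N) (F1 (cls ub) q0).
    by rewrite -bE.
  apply: (@locality N F1 F1 F1r F1r F1p F1p _ _ ub 0%N q0 (leqnn N) Sq0) => n a q _ nq.
    by have [] := F1loc n a q nq.
  by have [] := F1loc n a q nq.
(* t_ga and t_be raise the first index of every entry by m, so xx and yy live above degree N. *)
pose xx := F1 (wt ga) u; pose yy := F1 (wt be) (diag_fun 1).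
have xxE z : X z -> ext xx z = degree_shift X R (- m%:Z) (ext u (concat ga z)).
  by move=> Xz; rewrite /xx F1wt // szga.
have yyE z : X z -> ext yy z = degree_shift X R (- m%:Z) (ext (diag_fun 1) (concat be z)).
  by move=> Xz; rewrite /yy F1wt // szbe.
have k1N : (`|k1| <= N)%N.
  by rewrite leqNgt; apply/negP => Nk; apply: uk1; exact: (@supported_ext N u y1 (k1, x1) Su Nk).
(* The functionals lam and mu are normalised to 1 on a non-zero entry of xx and of yy; they yield
   phi and psi, which vanish up to degree N. *)
have [lam [lam_lin lam1]] : exists f : alg -> R^o, linear f /\
    f (ext xx y1' (k1 + m%:Z, x1)) = 1.
  apply: dual_vector; apply/eqP.
  by rewrite xxE // degree_shiftE y1tail addrK.
have [mu [mu_lin mu1]] : exists f : alg -> R^o, linear f /\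
    f (ext yy y' (m%:Z, y)) = 1.
  apply: dual_vector; rewrite yyE // degree_shiftE ytail subrr diagE // asboolT //.
  by apply/eqP => one0; apply: b0; rewrite -[b]mul1r one0 mul0r.
have ev_lin (f : alg -> R^o) z k : linear f -> linear (fun q : Q => f (ext q z k)).
  by move=> fl r q q'; rewrite ext_linear -fl.
pose phi := fun q : Q => lam (ext q y1' (k1 + m%:Z, x1)).
pose psi := fun q : Q => mu (ext q y' (m%:Z, y)).
have phi0 q : supported N q -> phi q = 0.
  move=> Nq; rewrite /phi (supported_ext _ Nq) /=; last by lia.
  have := lam_lin (-1) 0 0; by rewrite !scaleN1r !addNr.
have psi0 q : supported N q -> psi q = 0.
  move=> Nq; rewrite /psi (supported_ext _ Nq) /=; last by lia.
  have := mu_lin (-1) 0 0; by rewrite !scaleN1r !addNr.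
have trunc_xx : trunc N xx = 0.
  apply/funext => z; apply/funext => -[k x]; rewrite /trunc; case: ifP => //= kN.
  rewrite -ext_val xxE; last exact: svalP.
  by rewrite degree_shiftE (supported_ext _ Su) //=; lia.
have trunc_yy : trunc N yy = 0.
  apply/funext => z; apply/funext => -[k x]; rewrite /trunc; case: ifP => //= kN.
  rewrite -ext_val yyE; last exact: svalP.
  rewrite degree_shiftE (supported_ext _ (supported_diag 1)) //=; lia.
(* Truncation makes pi vanish on xx and yy and changes nothing on functions of degree up to N. *)
pose piN := fun q => pi (trunc N q).
have piN_lin : linear piN by move=> r q q'; rewrite /piN trunc_linear pi_lin.
have SNdiag v : supported N (diag_fun v) by apply: supported_mono (supported_diag v).
have piN_diag v : piN (diag_fun v) = v by rewrite /piN trunc_id.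
(* Only the letter a0 receives a perturbation of rank one. *)
pose at_a0 (q : Q) (a : A) : Q := if `[< a = a0 >] then q else 0.
have piN_at q a : trunc N q = 0 -> piN (at_a0 q a) = 0.
  rewrite /at_a0 => Tq; case: ifP => _; rewrite /piN ?Tq ?(lin0 _ _ (trunc_linear N));
  exact: lin0.
have at1 (f : Q -> R^o) (q q' : Q) a : f q = 1 ->
    f (at_a0 q a) *: at_a0 q' a = at_a0 q' a.
  by rewrite /at_a0 => fq; case: ifP => _; rewrite ?fq ?scale1r ?scaler0.
(* F2 agrees with F1 on functions supported in degrees up to N, so b q0 is still u, while s_a0 now
   sends xx to yy. *)
have [F2 [F2r F2p F2c F2o F2wt]] := over_rep piN_lin (ev_lin _ _ _ lam_lin)
  (ev_lin _ _ _ mu_lin) piN_diag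
  (fun v => phi0 _ (SNdiag v)) (fun v => psi0 _ (SNdiag v))
  (fun a => piN_at xx a trunc_xx) (fun a => piN_at yy a trunc_yy)
  (fun a => at1 phi xx yy a lam1) (fun a => at1 psi yy yy a mu1)
  (fun a => at1 phi xx xx a lam1) (fun a => at1 psi yy xx a mu1).
have F12 n a q : (n < N)%N -> supported n q ->
    F2 (s a) q = F1 (s a) q /\ F2 (t a) q = F1 (t a) q.
  move=> nN nq; have Nq := supported_mono (ltnW nN) nq.
  have [ca|nca] := pselect (core a).
    by have [-> ->] := F1c a ca; have [-> ->] := F2c a ca.
  have [-> ->] := F1o a q nca; have [-> ->] := F2o a q nca.
  rewrite /piN trunc_id // !scale0r.
  by rewrite [X in X *: _](phi0 _ Nq) [X in _ = _ /\ _ + X *: _ = _](psi0 _ Nq) !scale0r.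
have F2u : F2 b q0 = u.
  suff [] : F2 (cls ub) q0 = F1 (cls ub) q0 /\ supported (0 + N) (F1 (cls ub) q0).
    by rewrite -bE.
  apply: (@locality N F1 F2 F1r F2r F1p F2p _ _ ub 0%N q0 (leqnn N) Sq0) => n a q nN nq.
    by have [] := F12 n a q nN nq; have [] := F1loc n a q nq.
  by have [] := F12 n a q nN nq; have [] := F1loc n a q nq.
have F12wt w q : language X w -> F2 (wt w) q = F1 (wt w) q.
  by move=> lw; apply: extP => z Xz; rewrite F1wt // F2wt.
have F2x : F2 (s a0) xx = yy.
  have [-> _] := F2o a0 xx a0_out; rewrite /piN trunc_xx lin0 // mulr0.
  rewrite [X in X *: at_a0 _ _]lam1 scale1r /at_a0 asboolT //.
  by rewrite diag0 add0r.
have F2y : F2 (ws be) yy = q0.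
  rewrite /yy -F12wt // -lendME -rmorphM.
  have := sf_C H lnil lbe; rewrite word_t_nil word_s_nil !mulr1 => ->.
  by rewrite F2p.
(* Under F2, the factors of c b lead from q0 to u, xx, yy and back to q0, the last step because s_be
   t_be = p_C. *)
pose c := ws be * s a0 * wt ga.
have F2cb : F2 (c * b) q0 = q0.
  by rewrite rmorphM lendME F2u /c rmorphM lendME rmorphM lendME F12wt // -/xx F2x F2y.
have [v v1] := jacobson_quasiregular (jacobsonMl c Jb).
apply: uk1; have q00 : q0 = 0.
  rewrite -[q0]lend1E -(rmorph1 F2) -v1 rmorphM lendME rmorphB rmorph1.
  by rewrite lendDE lendNE lend1E F2cb subrr lend0.
by rewrite /u q00 lend0 ext0.
Qed.

End ForeignLetter.

Theorem proposition5p4 (A : Type) (hA : inhabited A)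
    (X : set (nat -> A)) (hX : subshift X) (R : fieldType) :
  semiprimitive (subshift_alg R X).
Proof.
apply/seteqP; split=> [b Jb|_ -> I [M [_ ->]] m]; last exact: scale0r.
have [all_core|/existsNP[a0 a0_out]] := pselect (forall a, language X [:: a]).
  exact: (radical_all_core hX).
exact: (radical_foreign_letter hX a0_out).
Qed.
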